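(* Let $d\geq 1$, let $\rho_0,\rho_T\in L^1(\mathbb{R}^d)$ be two probability densities, let $T>0$ and $\epsilon>0$. Then there exist piecewise constant controls $w,a\in BV((0,T);\mathbb{R}^d)$ and $b\in BV((0,T);\mathbb{R})$ such that the solution $\rho$ of \[ \begin{cases} \partial_t\rho+\mathrm{div}_x\big(w(t)\,\sigma(\langle a(t),x\rangle +b(t))\,\rho\big)=0, & (x,t)\in\mathbb{R}^d\times (0,T),\\ \rho(0)=\rho_0, \end{cases} \] satisfies $\|\rho(T)-\rho_T\|_{L^1(\mathbb{R}^d)}\leq \epsilon$.
   Context: $\sigma(z)=\max(z,0)$ is the ReLU function and $\langle\cdot,\cdot\rangle$ the Euclidean inner product. ''Piecewise constant'' means constant on each of finitely many subintervals of $(0,T)$. For bounded measurable controls the velocity field $V(x,t)=w(t)\sigma(\langle a(t),x\rangle+b(t))$ is globally Lipschitz in $x$, so the continuity equation is well-posed (solutions understood in the distributional sense, given by transport along the characteristics $x'=V(x,t)$). *)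

(* Defs.v *)
From HB Require Import structures.
From mathcomp Require Import all_boot all_order all_algebra.
From mathcomp Require Import all_classical all_reals all_analysis.
Set Implicit Arguments. Unset Strict Implicit. Unset Printing Implicit Defensive.
Import Order.TTheory GRing.Theory Num.Theory.
Import numFieldNormedType.Exports.
Local Open Scope classical_set_scope.
Local Open Scope ring_scope.

Section Defs.
Variable R : realType.

Definition relu (z : R) : R := Num.max z 0.

Definition inner (d : nat) (u v : 'rV[R]_d) : R := \sum_(i < d) u 0 i * v 0 i.

Definition relu_field (d : nat) (w a : R -> 'rV[R]_d) (b : R -> R)
  (t : R) (x : 'rV[R]_d) : 'rV[R]_d :=
  relu (inner (a t) x + b t) *: w t.

(* f is piecewise constant on (0,T): there are finitely many points s
   such that f is constant on each connected component of (0,T) \ s. *)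
Definition piecewise_constant (V : Type) (T : R) (f : R -> V) : Prop :=
  exists s : seq R, forall t1 t2 : R,
    0 < t1 < T -> 0 < t2 < T -> t1 \notin s -> t2 \notin s ->
    (forall c, c \in s -> (t1 < c) = (t2 < c)) -> f t1 = f t2.

Definition characteristic (d : nat) (T : R) (F : R -> 'rV[R]_d -> 'rV[R]_d)
  (X : R -> 'rV[R]_d) (x0 : 'rV[R]_d) : Prop :=
  X 0 = x0 /\ {within `[0, T], continuous X} /\
  exists S : seq R, forall t, 0 < t < T -> t \notin S ->
    is_derive t (1 : R) X (F t (X t)).

(* Borel structure on R^d: the product sigma-algebra on d.-tuple R. *)
Definition rV_of_tuple (d : nat) (u : d.-tuple R) : 'rV[R]_d := \row_i tnth u i.

Definition borel_set (d : nat) (A : set 'rV[R]_d) : Prop :=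
  measurable (@rV_of_tuple d @^-1` A).

Definition borel_fun (d : nat) (f : 'rV[R]_d -> R) : Prop :=
  measurable_fun setT (f \o @rV_of_tuple d).

(* Integral w.r.t. d-dimensional Lebesgue measure, as an iterated
   Lebesgue integral (this agrees with the Lebesgue integral on R^d for
   nonnegative Borel functions, by Tonelli; only such functions are
   integrated below). *)
Fixpoint lintegral (d : nat) : ('rV[R]_d -> \bar R) -> \bar R :=
  match d with
  | 0 => fun f => f 0
  | n.+1 => fun f =>
      (\int[@lebesgue_measure R]_x
         @lintegral n (fun y : 'rV[R]_n => f (row_mx (const_mx x : 'rV[R]_1) y)))%E
  end.

Definition prob_density (d : nat) (rho : 'rV[R]_d -> R) : Prop :=
  borel_fun rho /\ (forall x, 0 <= rho x) /\
  lintegral (fun x => (rho x)%:E) = 1%E.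

Definition pushforward_density (d : nat) (Phi : 'rV[R]_d -> 'rV[R]_d)
  (rho0 rho1 : 'rV[R]_d -> R) : Prop :=
  borel_fun rho1 /\ (forall x, 0 <= rho1 x) /\
  forall A : set 'rV[R]_d, borel_set A ->
    lintegral (fun x => (\1_A x * rho1 x)%:E) =
    lintegral (fun x => (\1_(Phi @^-1` A) x * rho0 x)%:E).

Definition L1dist (d : nat) (f g : 'rV[R]_d -> R) : \bar R :=
  lintegral (fun x => `|f x - g x|%:E).

End Defs.

(* Main.v *)
Require Import Defs.
From HB Require Import structures.
From mathcomp Require Import all_boot all_order all_algebra.
From mathcomp Require Import all_classical all_reals all_analysis.
From mathcomp Require Import measurable_realfun ring lra.
Set Implicit Arguments. Unset Strict Implicit. Unset Printing Implicit Defensive.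
Import Order.TTheory GRing.Theory Num.Theory.
Import numFieldNormedType.Exports.
Local Open Scope classical_set_scope.
Local Open Scope ring_scope.

(** The time-one maps x -> x + relu (<a, x> + b) w with 1 + <a, w> > 0 and their
    compositions form a group of homeomorphisms reachable by piecewise constant
    controls, acting isometrically on L^1 densities.  Being approximately
    transported into one another is therefore an equivalence relation stable
    under L^1 limits, and it suffices to bring every density to a multiple of the
    indicator of the unit cube.

    A density is L^1-close to one that is constant and positive on the cells of a
    uniform grid in a box, and zero outside; half-line dilations turn the cells
    into unit cubes.  Adding to x_i a step function of x_j is an L^1 limit of ReLU
    shears.  With such steps the rows of cells in direction j are lined up one
    after the other in direction 0, which leaves a single row of cells; dilations
    of the coordinate x_0 give each cell the length that makes its density 1. *)

(** * Borel maps on R^d and a measure behind the iterated integral *)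

Section Borel.
Variable R : realType.

(** Three obstacles shape the argument. Every move is a homeomorphism, so no exact move tears rows
    of cells apart; the discontinuous shears that do so are only limits, and this is why
    reachability carries an arbitrarily small error. Next, a cell is finally given a length equal to
    its density, and a cell of density zero would have to be collapsed; hence a small positive floor
    is added during the grid approximation. Last, L^1 approximation changes the mass, so the two
    given densities end at cubes of different heights; transports preserve mass, which forces both
    heights to be nearly equal, and the second path is then run backwards. The condition 1 + <a, w>
    > 0 appears because on the active half-space the ReLU argument is multiplied by that number:
    positivity keeps the half-space invariant and lets a linear flow realise the map in any
    prescribed time. Apart from this general form, only moves of a single coordinate occur, so each
    change of variables reduces to a one-dimensional one on lines. *)

Definition tuple_of_rV (d : nat) (x : 'rV[R]_d) : d.-tuple R :=
  [tuple x 0 i | i < d].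

Lemma tuple_of_rVK d : cancel (@tuple_of_rV d) (@rV_of_tuple R d).
Proof. by move=> x; apply/rowP => i; rewrite mxE tnth_mktuple. Qed.

Lemma rV_of_tupleK d : cancel (@rV_of_tuple R d) (@tuple_of_rV d).
Proof. by move=> u; apply: eq_from_tnth => i; rewrite tnth_mktuple mxE. Qed.

Definition borel_efun d (f : 'rV[R]_d -> \bar R) :=
  measurable_fun [set: d.-tuple R] (f \o @rV_of_tuple R d).

Definition borel_map d n (Phi : 'rV[R]_d -> 'rV[R]_n) :=
  forall i, borel_fun (fun x => Phi x 0 i).

Lemma borel_map_tuple d n (Phi : 'rV[R]_d -> 'rV[R]_n) : borel_map Phi ->
  measurable_fun setT (@tuple_of_rV n \o Phi \o @rV_of_tuple R d).
Proof.
move=> mPhi; apply/measurable_fun_tnthP => i.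
rewrite (_ : _ \o _ = (fun x => Phi x 0 i) \o @rV_of_tuple R d); first exact: mPhi.
by apply/funext => u /=; rewrite tnth_mktuple.
Qed.

Lemma borel_efun_comp d n (Phi : 'rV[R]_d -> 'rV[R]_n) (f : 'rV[R]_n -> \bar R) :
  borel_map Phi -> borel_efun f -> borel_efun (f \o Phi).
Proof.
move=> mPhi mf; rewrite /borel_efun.
rewrite (_ : _ \o _ = (f \o @rV_of_tuple R n) \o
  (@tuple_of_rV n \o Phi \o @rV_of_tuple R d)).
  exact: (measurableT_comp mf (borel_map_tuple mPhi)).
by apply/funext => u /=; rewrite tuple_of_rVK.
Qed.

Lemma borel_fun_comp d n (Phi : 'rV[R]_d -> 'rV[R]_n) (f : 'rV[R]_n -> R) :
  borel_map Phi -> borel_fun f -> borel_fun (f \o Phi).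
Proof.
move=> mPhi mf; rewrite /borel_fun.
rewrite (_ : _ \o _ = (f \o @rV_of_tuple R n) \o
  (@tuple_of_rV n \o Phi \o @rV_of_tuple R d)).
  exact: (measurableT_comp mf (borel_map_tuple mPhi)).
by apply/funext => u /=; rewrite tuple_of_rVK.
Qed.

Lemma borel_map_comp d n p (Phi : 'rV[R]_d -> 'rV[R]_n)
    (Psi : 'rV[R]_n -> 'rV[R]_p) :
  borel_map Phi -> borel_map Psi -> borel_map (Psi \o Phi).
Proof. by move=> mPhi mPsi i; apply: (borel_fun_comp mPhi (mPsi i)). Qed.

Lemma borel_coord d (i : 'I_d) : borel_fun (fun x : 'rV[R]_d => x 0 i).
Proof.
rewrite /borel_fun (_ : _ \o _ = (@tnth d R)^~ i); first exact: measurable_tnth.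
by apply/funext => u /=; rewrite mxE.
Qed.

Lemma borel_efunP d (f : 'rV[R]_d -> R) :
  borel_efun (fun x => (f x)%:E) <-> borel_fun f.
Proof. exact: measurable_EFinP. Qed.

Lemma rV_of_tuple_cons n (t : R) (u : n.-tuple R) :
  rV_of_tuple [the n.+1.-tuple R of t :: u] =
  row_mx (const_mx t : 'rV[R]_1) (rV_of_tuple u).
Proof.
apply/rowP => i; rewrite !mxE; case: splitP => j ij; rewrite !mxE.
  by rewrite (tnth_nth 0) /= ij ord1.
by rewrite !(tnth_nth 0) ij.
Qed.

Lemma measurable_cons_pair n :
  measurable_fun setT
    (fun p : R * n.-tuple R => [the n.+1.-tuple R of p.1 :: p.2]).
Proof. exact: measurable_cons. Qed.

Lemma borel_efun_cons n (f : 'rV[R]_n.+1 -> \bar R) : borel_efun f ->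
  measurable_fun setT (fun p : R * n.-tuple R =>
    f (row_mx (const_mx p.1 : 'rV[R]_1) (rV_of_tuple p.2))).
Proof.
move=> mf; rewrite (_ : (fun p => _) = (f \o @rV_of_tuple R n.+1) \o
  (fun p : R * n.-tuple R => [the n.+1.-tuple R of p.1 :: p.2])).
  by apply: (measurableT_comp mf); exact: measurable_cons_pair.
by apply/funext => p /=; rewrite rV_of_tuple_cons.
Qed.

(** Half-open with integer ends, so that it is a union of half-open grid cells of mesh [1 / N.+1]
    for every [N]; the same boxes witness sigma-finiteness. *)
Definition tuple_box d (M : nat) : set (d.-tuple R) :=
  [set u | forall i, - M%:R <= tnth u i < M%:R].

Lemma measurable_tuple_box d M : measurable (@tuple_box d M).
Proof.
rewrite (_ : tuple_box M = \bigcap_(i in [set: 'I_d])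
  ((@tnth d R)^~ i @^-1` `[- M%:R, M%:R[%classic)).
  apply: fin_bigcap_measurable => //.
  by move=> i _; rewrite -[X in measurable X]setTI; exact: measurable_tnth.
apply/seteqP; split=> u /=.
  by move=> uM i _ /=; rewrite in_itv /=; exact: uM.
by move=> uM i; have := uM i I; rewrite /= in_itv.
Qed.

Lemma bigcup_tuple_box d : \bigcup_M (@tuple_box d M) = setT.
Proof.
apply/seteqP; split=> // u _.
exists (\max_(i < d) (Num.bound `|tnth u i|)) => // i.
have : `|tnth u i| < (\max_(i < d) (Num.bound `|tnth u i|))%:R.
  apply: (lt_le_trans (archi_boundP (normr_ge0 _))).
  by rewrite ler_nat (leq_bigmax i).
by rewrite ltr_norml => /andP[/ltW -> ->].
Qed.

Lemma lintegralS n (f : 'rV[R]_n.+1 -> \bar R) :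
  lintegral f = (\int[@lebesgue_measure R]_x
    lintegral (fun y : 'rV[R]_n => f (row_mx (const_mx x : 'rV[R]_1) y)))%E.
Proof. by []. Qed.

(** Represents the recursively defined [lintegral] by a genuine measure, to which additivity and
    dominated convergence apply. The measure is built by induction as a product transported along
    [cons]. Finiteness on boxes is carried along because it gives the sigma-finiteness that Tonelli
    requires at the next dimension. *)
Lemma lebesgue_tuple_exists d :
  exists mu : {sigma_finite_measure set (d.-tuple R) -> \bar R},
    (forall M, mu (@tuple_box d M) < +oo)%E /\
    (forall f : 'rV[R]_d -> \bar R, borel_efun f -> (forall x, 0 <= f x)%E ->
      lintegral f = \int[mu]_u f (rV_of_tuple u))%E.
Proof.
elim: d => [|n [mu [muM muE]]].
  exists (\d_([tuple] : 0.-tuple R) : {sigma_finite_measure set (0.-tuple R) -> \bar R}).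
  split=> [M|f mf f0]; first by rewrite /= diracE; case: (_ \in _); rewrite ltey.
  rewrite /= (integral_dirac _ measurableT mf) diracT mul1e /=.
  by congr f; rewrite [RHS]thinmx0.
pose phi := fun p : R * n.-tuple R => [the n.+1.-tuple R of p.1 :: p.2].
have mphi : measurable_fun setT phi by exact: measurable_cons_pair.
pose push : {measure set (n.+1.-tuple R) -> \bar R} :=
  pushforward (@lebesgue_measure R \x mu)%E phi.
pose nu := push mphi.
have nuM M : (nu (@tuple_box n.+1 M) < +oo)%E.
  rewrite /= /pushforward.
  have -> : phi @^-1` tuple_box M = `[- M%:R, M%:R[%classic `*` @tuple_box n M.
    apply/seteqP; split=> -[t u] /= uM.
      split; first by have := uM ord0; rewrite in_itv.
      by move=> i /=; have := uM (lift ord0 i); rewrite tnthS.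
    case: uM; rewrite in_itv /= => tM uM i.
    by case: (unliftP ord0 i) => [j|] -> /=; rewrite ?tnthS//; exact: uM.
  rewrite product_measure1E//; last exact: measurable_tuple_box.
  have MM : @lebesgue_measure R `[- M%:R, M%:R[%classic \is a fin_num.
    by rewrite lebesgue_measure_itv /=; case: ifP.
  by rewrite lte_mul_pinfty.
have sf : sigma_finite setT nu.
  exists (@tuple_box n.+1); first by rewrite bigcup_tuple_box.
  by move=> M; split; [exact: measurable_tuple_box|exact: nuM].
pose nus : {sigma_finite_measure set (n.+1.-tuple R) -> \bar R} :=
  HB.pack (Measure.sort nu) (Measure_isSigmaFinite.Build _ _ _ nu sf).
exists nus; split; first exact: nuM.
move=> f mf f0.
have mf2 := borel_efun_cons mf.
transitivity (\int[@lebesgue_measure R]_x \int[mu]_u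
    f (row_mx (const_mx x : 'rV[R]_1) (rV_of_tuple u)))%E.
  rewrite lintegralS; apply: eq_integral => x _; rewrite muE//.
  exact: (measurableT_comp mf2 (measurable_pair1 _)).
transitivity (\int[@lebesgue_measure R \x mu]_p
   f (row_mx (const_mx p.1 : 'rV[R]_1) (rV_of_tuple p.2)))%E.
  by rewrite fubini_tonelli1.
rewrite [RHS](_ : _ = \int[pushforward (@lebesgue_measure R \x mu) phi]_u
  (f \o @rV_of_tuple R n.+1) u)%E//.
rewrite ge0_integral_pushforward//= preimage_setT.
by apply: eq_integral => p _ /=; rewrite rV_of_tuple_cons.
Qed.

End Borel.

(** * Integration along the lines parallel to a coordinate axis *)

Section Fiber.
Variable R : realType.

Definition leb d : {sigma_finite_measure set (d.-tuple R) -> \bar R} :=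
  sval (cid (lebesgue_tuple_exists R d)).

Lemma leb_box d M : (leb d (@tuple_box R d M) < +oo)%E.
Proof. by rewrite /leb; case: cid => mu []. Qed.

Lemma lintegralE d (f : 'rV[R]_d -> \bar R) :
  borel_efun f -> (forall x, 0 <= f x)%E ->
  lintegral f = (\int[leb d]_u f (rV_of_tuple u))%E.
Proof. by rewrite /leb; case: cid => mu [] _ /= + mf f0; exact. Qed.

Definition upd d (i : 'I_d) (x : 'rV[R]_d) (t : R) : 'rV[R]_d :=
  \row_j if j == i then t else x 0 j.

Lemma row_mx_upd0 n (t s : R) (y : 'rV[R]_n) :
  row_mx (const_mx t : 'rV[R]_1) y =
  @upd n.+1 ord0 (row_mx (const_mx s : 'rV[R]_1) y) t.
Proof.
apply/rowP => j; rewrite !mxE; case: splitP => k jk.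
  have -> : j = ord0 by apply/val_inj; rewrite /= jk ord1.
  by rewrite eqxx mxE.
by case: eqP => // j0; rewrite j0 in jk.
Qed.

Lemma row_mx_updS n (s t : R) (i : 'I_n) (y : 'rV[R]_n) :
  @upd n.+1 (lift ord0 i) (row_mx (const_mx s : 'rV[R]_1) y) t =
  row_mx (const_mx s : 'rV[R]_1) (upd i y t).
Proof.
apply/rowP => j; rewrite !mxE; case: splitP => k jk.
  rewrite !mxE; case: eqP => // ji; move: jk; rewrite ji /= /bump /=.
  by case: k => -[].
rewrite !mxE; congr (if _ then _ else _); apply/eqP/eqP => [ji|ki].
  by apply/val_inj; move: jk; rewrite ji /= /bump /=; case.
by apply/val_inj; rewrite /= jk ki.
Qed.

Lemma lintegral_swap n (f : 'rV[R]_n.+1 -> \bar R) :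
  borel_efun f -> (forall x, 0 <= f x)%E ->
  lintegral f = (\int[leb n]_u \int[@lebesgue_measure R]_t
    f (row_mx (const_mx t : 'rV[R]_1) (rV_of_tuple u)))%E.
Proof.
move=> mf f0; have mf2 := borel_efun_cons mf.
rewrite lintegralS.
transitivity (\int[@lebesgue_measure R]_t \int[leb n]_u
    f (row_mx (const_mx t : 'rV[R]_1) (rV_of_tuple u)))%E; last first.
  apply: (@fubini_tonelli _ _ _ _ R (@lebesgue_measure R) (leb n)
    (fun p => f (row_mx (const_mx p.1 : 'rV[R]_1) (rV_of_tuple p.2)))) => //.
apply: eq_integral => t _; rewrite lintegralE//.
exact: (measurableT_comp mf2 (measurable_pair1 _)).
Qed.

(** Reduces a change of variables that moves one coordinate to dimension one. Outer coordinates are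
    peeled off until [i] is the outermost one; Tonelli then makes it the innermost. *)
Lemma lintegral_fiber d (i : 'I_d) (f g : 'rV[R]_d -> \bar R) :
  borel_efun f -> (forall x, 0 <= f x)%E ->
  borel_efun g -> (forall x, 0 <= g x)%E ->
  (forall x, \int[@lebesgue_measure R]_t f (upd i x t) =
             \int[@lebesgue_measure R]_t g (upd i x t))%E ->
  lintegral f = lintegral g.
Proof.
elim: d i f g => [[]//|n IH] i f g mf f0 mg g0 fg.
case: (unliftP ord0 i) => [j|] ij; last first.
  rewrite !lintegral_swap//; apply: eq_integral => u _.
  have := fg (row_mx (const_mx 0 : 'rV[R]_1) (rV_of_tuple u)).
  rewrite ij; under eq_integral do rewrite -row_mx_upd0.
  by under [in RHS]eq_integral do rewrite -row_mx_upd0.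
rewrite !lintegralS; apply: eq_integral => s _; apply: (IH j) => //.
- exact: (measurableT_comp (borel_efun_cons mf) (measurable_pair1 _)).
- exact: (measurableT_comp (borel_efun_cons mg) (measurable_pair1 _)).
move=> x; have := fg (row_mx (const_mx s : 'rV[R]_1) x).
rewrite ij; under eq_integral do rewrite row_mx_updS.
by under [in RHS]eq_integral do rewrite row_mx_updS.
Qed.

End Fiber.

(** * One-dimensional changes of variable *)

Section ChangeOfVariable.
Variable R : realType.
Local Notation mu := (@lebesgue_measure R).

(** Lebesgue measure equals [s] times its image under [s * t + v], because the two agree on
    half-open intervals. *)
Lemma integral_affine (f : R -> \bar R) (s v : R) : 0 < s ->
  measurable_fun setT f -> (forall t, 0 <= f t)%E ->
  (\int[mu]_t f t = s%:E * \int[mu]_t f (s * t + v)%R)%E.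
Proof.
move=> s0 mf f0.
pose phi : measurableTypeR R -> measurableTypeR R := fun t : R => s * t + v.
have mphi : measurable_fun setT phi.
  by apply: measurable_funD => //; exact: measurable_funM.
pose push : {measure set (measurableTypeR R) -> \bar R} := pushforward mu phi.
pose nu : {measure set (measurableTypeR R) -> \bar R} :=
  mscale (NngNum (ltW s0)) (push mphi).
have munu A : measurable A -> mu A = nu A.
  apply: lebesgue_measure_unique => _ [[a b]] _ <- /=.
  rewrite /mscale /= /pushforward.
  have -> : phi @^-1` `]a, b]%classic = `](a - v) / s, (b - v) / s]%classic.
    apply/seteqP; split=> t /=; rewrite !in_itv /= /phi.
      by rewrite ltr_pdivrMr// ler_pdivlMr// ltrBlDr lerBrDr (mulrC t).
    by rewrite ltr_pdivrMr// ler_pdivlMr// ltrBlDr lerBrDr (mulrC t).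
  rewrite !lebesgue_measure_itv /= !lte_fin ltr_pM2r ?invr_gt0// ltrD2r.
  case: ifP => _; last by rewrite mule0.
  by rewrite -!EFinB -EFinM; congr EFin; field; rewrite gt_eqF.
rewrite (eq_measure_integral nu)//=; last by move=> A mA _; exact: munu.
rewrite ge0_integral_mscale//=; congr (_ * _)%E.
by rewrite ge0_integral_pushforward//= preimage_setT.
Qed.

Lemma integral_shift (f : R -> \bar R) (v : R) :
  measurable_fun setT f -> (forall t, 0 <= f t)%E ->
  (\int[mu]_t f (t + v)%R = \int[mu]_t f t)%E.
Proof.
move=> mf f0; rewrite (integral_affine v ltr01 mf f0) mul1e.
by under [in RHS]eq_integral do rewrite mul1r.
Qed.

(** The map fixes [c] and preserves both sides of it, so [f] is cut at [c]: the left piece is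
    unchanged and the right one is an affine substitution. The weight is the Jacobian of the inverse
    map. *)
Lemma integral_dilate (f : R -> \bar R) (c s : R) : 0 < s ->
  measurable_fun setT f -> (forall t, 0 <= f t)%E ->
  (\int[mu]_t f (t + (s - 1) * relu (t - c))%R =
   \int[mu]_t (f t * (if t < c then 1 else s^-1)%R%:E))%E.
Proof.
move=> s0 mf f0.
pose f1 (t : R) := if t < c then f t else 0%E.
pose f2 (t : R) := if t < c then 0%E else f t.
have mlt : measurable_fun setT (fun t : R => t < c) by exact: measurable_fun_ltr.
have mf1 : measurable_fun setT f1 by apply: measurable_fun_ifT.
have mf2 : measurable_fun setT f2 by apply: measurable_fun_ifT.
have f10 t : (0 <= f1 t)%E by rewrite /f1; case: ifP.
have f20 t : (0 <= f2 t)%E by rewrite /f2; case: ifP.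
have maff : measurable_fun setT (fun t : R => s * t + (c - s * c)).
  by apply: measurable_funD => //; exact: measurable_funM.
transitivity (\int[mu]_t (f1 t + f2 (s * t + (c - s * c))%R))%E.
  apply: eq_integral => t _; rewrite /f1 /f2 /relu.
  have -> : (s * t + (c - s * c) < c) = (t < c).
    rewrite -subr_gt0 -[in RHS]subr_gt0.
    have -> : c - (s * t + (c - s * c)) = s * (c - t) by ring.
    by rewrite pmulr_rgt0.
  case: ltP => tc; first by rewrite max_r ?subr_le0 1?ltW// mulr0 addr0 adde0.
  by rewrite add0e max_l ?subr_ge0//; congr f; ring.
rewrite ge0_integralD//; last exact: (measurableT_comp mf2 maff).
transitivity (\int[mu]_t (f1 t + (s^-1)%R%:E * f2 t))%E; last first.
  apply: eq_integral => t _; rewrite /f1 /f2.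
  by case: ifP => _; rewrite ?mule0 ?adde0 ?mule1 ?add0e// muleC.
rewrite ge0_integralD//; last 2 first.
- by move=> t _; rewrite mule_ge0// lee_fin invr_ge0 ltW.
- by apply: measurable_funeM.
rewrite ge0_integralZl//; last by rewrite lee_fin invr_ge0 ltW.
rewrite (integral_affine (c - s * c) s0 mf2 f20) muleA -EFinM mulVf ?gt_eqF//.
by rewrite mul1e.
Qed.

End ChangeOfVariable.

(** * Flows of piecewise constant ReLU fields *)

Section Flow.
Variable R : realType.

Lemma is_derive_rowP d (X : R -> 'rV[R]_d) (t : R) (D : 'rV[R]_d) :
  is_derive t 1 X D <-> forall j, is_derive t 1 (fun s => X s 0 j) (D 0 j).
Proof.
split=> [[dX <-] j|dX].
  by apply: DeriveDef; [exact: (derivable_mxP _ _ _).1|rewrite derive_mx// mxE].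
have dX' : derivable X t 1.
  by apply/derivable_mxP => i j; rewrite ord1; exact: (@ex_derive _ _ _ _ _ _ _ (dX j)).
apply: DeriveDef => //; rewrite derive_mx//; apply/rowP => j; rewrite mxE.
exact: (@derive_val _ _ _ _ _ _ _ (dX j)).
Qed.

Lemma is_derive_subr d (X : R -> 'rV[R]_d) (t tau : R) (D : 'rV[R]_d) :
  is_derive (t - tau) 1 X D -> is_derive t 1 (fun s => X (s - tau)) D.
Proof.
move=> /is_derive_rowP dX; apply/is_derive_rowP => j.
rewrite -[D 0 j]mulr1.
exact: (@is_derive1_comp _ (fun s => X s 0 j) (shift (- tau)) t _ _ (dX j)
  (is_derive_shift _ _ _)).
Qed.

(** Quantified over all durations, so that a composition can give each factor half of the time.
    Trajectories are continuous on the whole line, which makes them easy to glue. *)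
Definition steerable d (Phi : 'rV[R]_d -> 'rV[R]_d) :=
  forall T : R, 0 < T -> exists (w a : R -> 'rV[R]_d) (b : R -> R),
    [/\ piecewise_constant T w, piecewise_constant T a, piecewise_constant T b &
     exists X : 'rV[R]_d -> R -> 'rV[R]_d, forall x,
       [/\ X x 0 = x, continuous (X x), X x T = Phi x &
        exists S : seq R, forall t, 0 < t < T -> t \notin S ->
          is_derive t (1 : R) (X x) (relu_field w a b t (X x t))]].

Lemma inner_addr d (a x y : 'rV[R]_d) : inner a (x + y) = inner a x + inner a y.
Proof.
by rewrite /inner -big_split; apply: eq_bigr => i _; rewrite mxE mulrDr.
Qed.

Lemma inner_scaler d (a x : 'rV[R]_d) k : inner a (k *: x) = k * inner a x.
Proof.
by rewrite /inner big_distrr; apply: eq_bigr => i _; rewrite mxE /= mulrCA.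
Qed.

(** With [1 + k] positive the displacement never changes the sign of the ReLU argument: inactive
    points stay put and active ones stay active. *)
Lemma relu_stretch (z k : R) : 0 < 1 + k -> relu (z + relu z * k) = relu z * (1 + k).
Proof.
rewrite /relu => k0; case: (leP z 0) => z0; first by rewrite !mul0r addr0 max_r.
by rewrite max_l; rewrite -{1}[z]mulr1 -mulrDr// mulr_ge0 ?ltW.
Qed.

(* [theta] solves the scalar equation obeyed by the displacement along [w] on
   the half-space where the ReLU is active. *)
Lemma stretch_profile (T kappa : R) : 0 < T -> 0 < 1 + kappa ->
  exists (theta : R -> R) (k : R), [/\ theta 0 = 0, theta T = 1,
    forall t, 0 < 1 + kappa * theta t &
    forall t, is_derive t (1 : R) theta (k * (1 + kappa * theta t))].
Proof.
move=> T0 kappa1; have TN0 : T != 0 by rewrite gt_eqF.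
have [->|kappaN0] := eqVneq kappa 0.
  exists (fun t => T^-1 * t), T^-1; split.
  - by rewrite mulr0.
  - by rewrite mulVf.
  - by move=> t; rewrite mul0r addr0.
  - move=> t; rewrite mul0r addr0 -[X in is_derive _ _ _ X]/(T^-1 *: (1 : R)).
    exact: is_deriveZ.
pose l := ln (1 + kappa) / T.
have Eth t : 1 + kappa * (kappa^-1 * (expR (l * t) - 1)) = expR (l * t).
  by rewrite mulrA mulfV// mul1r addrC subrK.
exists (fun t => kappa^-1 * (expR (l * t) - 1)), (kappa^-1 * l); split.
- by rewrite mulr0 expR0 subrr mulr0.
- by rewrite /l divfK// lnK ?posrE// addrAC subrr add0r mulVf.
- by move=> t; rewrite Eth expR_gt0.
- move=> t; rewrite Eth -mulrA.
  apply: is_deriveZ; rewrite -[X in is_derive _ _ _ X]subr0.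
  apply: is_deriveB; rewrite mulrC.
  have -> : (fun t : R => expR (l * t)) = expR \o (fun t => l * t) by [].
  apply: is_derive1_comp.
  rewrite -[X in is_derive _ _ _ X]mulr1.
  exact: is_deriveZ.
Qed.

Lemma piecewise_constant_cst (V : Type) (T : R) (v : V) :
  piecewise_constant T (fun=> v).
Proof. by exists [::]. Qed.

(** Under the constant controls [k *: w], [a], [b] a point moves along [w] only, and its ReLU
    argument obeys a linear equation with rate [k * inner a w]. The displacement is therefore the
    initial ReLU value times a profile common to all points: affine if [inner a w] is 0, exponential
    otherwise. *)
Lemma steerable_relu d (a w : 'rV[R]_d) (b : R) : 0 < 1 + inner a w ->
  steerable (fun x => x + relu (inner a x + b) *: w).
Proof.
move=> aw T T0; have [theta [k [th0 thT thpos dth]]] := stretch_profile T0 aw.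
exists (fun=> k *: w), (fun=> a), (fun=> b).
split; [exact: piecewise_constant_cst..|].
exists (fun x t => x + (relu (inner a x + b) * theta t) *: w) => x.
have dX t : is_derive t (1 : R)
    (fun t => x + (relu (inner a x + b) * theta t) *: w)
    (relu_field (fun=> k *: w) (fun=> a) (fun=> b) t
       (x + (relu (inner a x + b) * theta t) *: w)).
  apply/is_derive_rowP => j; rewrite /relu_field.
  rewrite inner_addr inner_scaler addrAC -mulrA relu_stretch; last first.
    by rewrite mulrC; exact: thpos.
  have -> : (fun s => (x + (relu (inner a x + b) * theta s) *: w) 0 j) =
      (fun s => x 0 j + (w 0 j * relu (inner a x + b)) * theta s).
    by apply/funext => s; rewrite !mxE; ring.
  rewrite !mxE -[X in is_derive _ _ _ X]add0r; apply: is_deriveD.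
  rewrite [X in is_derive _ _ _ X](_ : _ =
    (w 0 j * relu (inner a x + b)) *: (k * (1 + inner a w * theta t))); last first.
    by rewrite /GRing.scale /=; ring.
  exact: is_deriveZ.
split.
- by rewrite th0 mulr0 scale0r addr0.
- move=> t; apply: differentiable_continuous; apply/derivable1_diffP.
  exact: (@ex_derive _ _ _ _ _ _ _ (dX t)).
- by rewrite thT mulr1.
- by exists [::] => t _ _; exact: dX.
Qed.

Lemma piecewise_constant_cat (V : Type) (T tau : R) (f g : R -> V) :
  0 < tau < T ->
  piecewise_constant tau f -> piecewise_constant (T - tau) g ->
  piecewise_constant T (fun t => if t < tau then f t else g (t - tau)).
Proof.
move=> /andP[tau0 tauT] [s fs] [r gr].
(* Listing the switching time [tau] forces two compared times to lie on the same side of it. *)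
exists (tau :: s ++ map (+%R tau) r) => t1 t2 /andP[t10 t1T] /andP[t20 t2T].
rewrite !inE !negb_or !mem_cat !negb_or => /and3P[t1tau t1s t1r] /and3P[t2tau t2s t2r] h.
have htau : (t1 < tau) = (t2 < tau) by apply: h; rewrite inE eqxx.
rewrite -htau; case: ifP => t1t.
  apply: fs => //; rewrite ?t10 ?t20 ?t1t -?htau//.
  by move=> c cs; apply: h; rewrite inE mem_cat cs orbT.
have t1t' : tau < t1 by rewrite lt_neqAle eq_sym t1tau leNgt t1t.
have t2t' : tau < t2 by rewrite lt_neqAle eq_sym t2tau leNgt -htau t1t.
have memr t c : (t - tau \in r) -> t \in map (+%R tau) r.
  by move=> tr; apply/mapP; exists (t - tau) => //; rewrite addrC subrK.
apply: gr; rewrite ?subr_gt0 ?ltrD2r ?t1t' ?t2t' ?t1T ?t2T//.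
- by apply: contra t1r; exact: memr.
- by apply: contra t2r; exact: memr.
- move=> c cr; rewrite !ltrBlDr !(addrC c); apply: h.
  by rewrite inE mem_cat (map_f (+%R tau)) ?orbT.
Qed.

Lemma steerable_comp d (Phi Psi : 'rV[R]_d -> 'rV[R]_d) :
  steerable Phi -> steerable Psi -> steerable (Psi \o Phi).
Proof.
move=> sPhi sPsi T T0; pose tau := T / 2.
have tau0 : 0 < tau by rewrite divr_gt0.
have Ttau : T - tau = tau by rewrite /tau; field.
have [w1 [a1 [b1 [pw1 pa1 pb1 [X1 hX1]]]]] := sPhi tau tau0.
have [w2 [a2 [b2 [pw2 pa2 pb2 [X2 hX2]]]]] := sPsi tau tau0.
have tauT : 0 < tau < T by rewrite tau0 /= -subr_gt0 Ttau.
pose glue V (f g : R -> V) t := if t < tau then f t else g (t - tau).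
exists (glue _ w1 w2), (glue _ a1 a2), (glue _ b1 b2).
split; try by apply: piecewise_constant_cat; rewrite ?Ttau.
pose X x t := X1 x (Num.min t tau) + X2 (Phi x) (Num.max t tau - tau) - Phi x.
exists X => x.
have [X10 cX1 X1T [S1 dX1]] := hX1 x.
have [X20 cX2 X2T [S2 dX2]] := hX2 (Phi x).
have Xl t : t <= tau -> X x t = X1 x t.
  by move=> tt; rewrite /X min_l// max_r// subrr X20 addrK.
have Xr t : tau <= t -> X x t = X2 (Phi x) (t - tau).
  by move=> tt; rewrite /X min_r// max_l// X1T addrC addKr.
split.
- by rewrite Xl// ltW.
- move=> t; rewrite /X; apply: cvgB; last exact: cvg_cst.
  apply: cvgD.
    apply: (@continuous_comp _ _ _ (fun t => Num.min t tau) (X1 x)); last exact: cX1.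
    by apply: continuous_min; [exact: cvg_id|exact: cvg_cst].
  apply: (@continuous_comp _ _ _ (fun t => Num.max t tau - tau) (X2 (Phi x))).
    apply: cvgB; last exact: cvg_cst.
    apply: (@continuous_max _ _ (fun t => t) (fun=> tau) t).
      exact: cvg_id.
    exact: cvg_cst.
  exact: cX2.
- by rewrite Xr ?Ttau ?X2T// ltW//; case/andP: tauT.
- exists (tau :: S1 ++ map (+%R tau) S2) => t /andP[t0 tT].
  rewrite inE mem_cat !negb_or => /and3P[ttau tS1 tS2].
  case: (ltgtP t tau) => tt; last by rewrite tt eqxx in ttau.
    rewrite Xl ?ltW// /relu_field /glue tt.
    apply: (@near_eq_is_derive _ _ _ (X1 x)); last first.
      by apply: dX1 => //; rewrite t0.
    near=> s; rewrite Xl//; apply/ltW; near: s.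
    exact: lt_nbhsl.
  rewrite Xr ?ltW// /relu_field /glue ltNge (ltW tt) /=.
  apply: (@near_eq_is_derive _ _ _ (fun s => X2 (Phi x) (s - tau))); last first.
    apply: is_derive_subr; apply: dX2; first by rewrite subr_gt0 tt -{2}Ttau ltrD2r.
    apply: contra tS2 => tS2; apply/mapP; exists (t - tau) => //.
    by rewrite addrC subrK.
  near=> s; rewrite Xr//; apply/ltW; near: s.
  exact: lt_nbhsr.
Unshelve. all: by end_near. Qed.

End Flow.

(** * The group of steerable transports and its action on densities *)

Section Transport.
Variables (R : realType) (d : nat).
Implicit Types (f g h rho : 'rV[R]_d -> R) (F G : 'rV[R]_d -> \bar R).

Lemma borel_cst (c : R) : borel_fun (fun _ : 'rV[R]_d => c).
Proof. exact: measurable_cst. Qed.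

Lemma borelD f g : borel_fun f -> borel_fun g -> borel_fun (fun x => f x + g x).
Proof. by move=> mf mg; exact: (measurable_funD mf mg). Qed.

Lemma borelB f g : borel_fun f -> borel_fun g -> borel_fun (fun x => f x - g x).
Proof. by move=> mf mg; exact: (measurable_funB mf mg). Qed.

Lemma borel_opp h : borel_fun h -> borel_fun (fun x => - h x).
Proof.
move=> mh; have := borelB (borel_cst 0) mh.
by congr borel_fun; apply/funext => x; rewrite sub0r.
Qed.

Lemma borelM f g : borel_fun f -> borel_fun g -> borel_fun (fun x => f x * g x).
Proof. by move=> mf mg; exact: (measurable_funM mf mg). Qed.

Lemma borel_norm f : borel_fun f -> borel_fun (fun x => `|f x|).
Proof.
move=> mf; exact: (measurableT_comp (@normr_measurable R setT) mf).
Qed.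

Lemma borel_max f g : borel_fun f -> borel_fun g ->
  borel_fun (fun x => Num.max (f x) (g x)).
Proof. by move=> mf mg; exact: (measurable_maxr mf mg). Qed.

Lemma borel_relu f : borel_fun f -> borel_fun (fun x => relu (f x)).
Proof. by move=> mf; exact: borel_max mf (borel_cst 0). Qed.

Lemma borel_if_lt f g h1 h2 : borel_fun f -> borel_fun g -> borel_fun h1 ->
  borel_fun h2 -> borel_fun (fun x => if f x < g x then h1 x else h2 x).
Proof.
move=> mf mg m1 m2; apply: (measurable_fun_ifT _ m1 m2).
exact: (measurable_fun_ltr mf mg).
Qed.

Lemma borel_ltb f g : borel_fun f -> borel_fun g ->
  borel_fun (fun x => (f x < g x)%R%:R).
Proof.
move=> mf mg; have := borel_if_lt mf mg (borel_cst 1) (borel_cst 0).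
by congr borel_fun; apply/funext => x; case: ifP.
Qed.

Lemma borel_leb f g : borel_fun f -> borel_fun g ->
  borel_fun (fun x => (f x <= g x)%R%:R).
Proof.
move=> mf mg; have := borel_if_lt mg mf (borel_cst 0) (borel_cst 1).
by congr borel_fun; apply/funext => x; rewrite leNgt; case: ifP.
Qed.

Lemma borel_efunM F f : borel_efun F -> borel_fun f ->
  borel_efun (fun x => F x * (f x)%:E)%E.
Proof.
by move=> mF /borel_efunP mf; exact: (emeasurable_funM mF mf).
Qed.

Lemma le_lintegral F G : borel_efun F -> borel_efun G ->
  (forall x, 0 <= F x)%E -> (forall x, F x <= G x)%E ->
  (lintegral F <= lintegral G)%E.
Proof.
move=> mF mG F0 FG; have G0 x : (0 <= G x)%E by exact: le_trans (FG x).
by rewrite !lintegralE//; apply: ge0_le_integral.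
Qed.

Lemma lintegral_ge0 F : borel_efun F -> (forall x, 0 <= F x)%E ->
  (0 <= lintegral F)%E.
Proof. by move=> mF F0; rewrite lintegralE//; apply: integral_ge0. Qed.

Lemma lintegralD F G : borel_efun F -> borel_efun G ->
  (forall x, 0 <= F x)%E -> (forall x, 0 <= G x)%E ->
  (lintegral (fun x => F x + G x) = lintegral F + lintegral G)%E.
Proof.
move=> mF mG F0 G0; rewrite !lintegralE//; last 2 first.
- exact: (emeasurable_funD mF mG).
- by move=> x; exact: adde_ge0.
exact: ge0_integralD.
Qed.

Lemma lintegralZl F (k : R) : borel_efun F -> (forall x, 0 <= F x)%E -> 0 <= k ->
  (lintegral (fun x => k%:E * F x) = k%:E * lintegral F)%E.
Proof.
move=> mF F0 k0; rewrite !lintegralE//; last 2 first.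
- exact: (measurable_funeM _ mF).
- by move=> x; rewrite mule_ge0.
exact: ge0_integralZl.
Qed.

Lemma borel_L1 f g : borel_fun f -> borel_fun g ->
  borel_efun (fun x => `|f x - g x|%:E).
Proof.
by move=> mf mg; apply/borel_efunP; apply: borel_norm; exact: borelB mf mg.
Qed.

Lemma L1distC f g : L1dist f g = L1dist g f.
Proof.
rewrite /L1dist; congr lintegral; apply/funext => x.
by rewrite distrC.
Qed.

Lemma L1dist_triangle f g h : borel_fun f -> borel_fun g -> borel_fun h ->
  (L1dist f h <= L1dist f g + L1dist g h)%E.
Proof.
move=> mf mg mh; have ? := borel_L1 mf mg; have ? := borel_L1 mg mh.
rewrite /L1dist -lintegralD//.
apply: le_lintegral => [| |x|x]; rewrite ?lee_fin//; first exact: borel_L1.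
  exact: (emeasurable_funD (borel_L1 mf mg) (borel_L1 mg mh)).
exact: ler_distD.
Qed.

Lemma L1distxx f : L1dist f f = 0%E.
Proof.
rewrite /L1dist (_ : (fun x => _) = (fun x => 0%E)).
  by rewrite lintegralE//; [exact: integral0|exact: measurable_cst].
by apply/funext => x; rewrite subrr normr0.
Qed.

(* The density of the image of rho under a map with inverse Psi, J being the
   Jacobian of Psi. *)
Definition push (Psi : 'rV[R]_d -> 'rV[R]_d) J rho y := rho (Psi y) * J y.

(** Steerability and measurability are required of [Psi] and of the reciprocal Jacobian as well, so
    that the notion is closed under inversion. The change of variables is stated for nonnegative
    integrands, where [lintegral] is a true integral. *)
Record transport (Phi Psi : 'rV[R]_d -> 'rV[R]_d) J : Prop := Transport {
  transport_steer : steerable Phi;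
  transport_steerV : steerable Psi;
  transportK : cancel Phi Psi;
  transportVK : cancel Psi Phi;
  transport_borel : borel_map Phi;
  transport_borelV : borel_map Psi;
  transport_borelJ : borel_fun J;
  transport_borelJV : borel_fun (fun y => (J y)^-1);
  transport_gt0 : forall y, 0 < J y;
  transport_change : forall F, borel_efun F -> (forall x, 0 <= F x)%E ->
    lintegral (F \o Phi) = lintegral (fun y => F y * (J y)%:E)%E
}.

Lemma borel_push Phi Psi J rho : transport Phi Psi J -> borel_fun rho ->
  borel_fun (push Psi J rho).
Proof.
move=> tr mrho; apply: borelM; last exact: transport_borelJ tr.
exact: (borel_fun_comp (transport_borelV tr) mrho).
Qed.

Lemma lintegral_push Phi Psi J F : transport Phi Psi J ->
  borel_efun F -> (forall x, 0 <= F x)%E ->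
  lintegral (fun y => F (Psi y) * (J y)%:E)%E = lintegral F.
Proof.
move=> tr mF F0; rewrite -(transport_change tr (F := F \o Psi)) => [|| x] //=.
  by congr lintegral; apply/funext => x /=; rewrite (transportK tr).
exact: borel_efun_comp (transport_borelV tr) mF.
Qed.

Lemma L1dist_push Phi Psi J f g : transport Phi Psi J ->
  borel_fun f -> borel_fun g ->
  L1dist (push Psi J f) (push Psi J g) = L1dist f g.
Proof.
move=> tr mf mg; rewrite /L1dist -(lintegral_push tr (borel_L1 mf mg))//.
congr lintegral; apply/funext => y; rewrite /push -mulrBl normrM -EFinM.
by rewrite (gtr0_norm (transport_gt0 tr y)).
Qed.

Lemma pushforward_density_push Phi Psi J rho : transport Phi Psi J ->
  borel_fun rho -> (forall x, 0 <= rho x) ->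
  pushforward_density Phi rho (push Psi J rho).
Proof.
move=> tr mrho rho0; split; first exact: borel_push tr mrho.
split=> [x|A mA]; first by rewrite mulr_ge0// ltW// (transport_gt0 tr).
have mF : borel_efun (fun x => (\1_(Phi @^-1` A) x * rho x)%:E).
  apply/borel_efunP; apply: borelM => //.
  apply: (borel_fun_comp (transport_borel tr) (f := \1_A)).
  exact: (measurable_indic mA).
rewrite -(lintegral_push tr mF); last by move=> x; rewrite lee_fin mulr_ge0.
congr lintegral; apply/funext => y; rewrite /push -EFinM mulrA.
rewrite !indicE (_ : (Psi y \in Phi @^-1` A) = (y \in A))//.
by apply/idP/idP; rewrite !inE /preimage /= (transportVK tr).
Qed.

Lemma steerable_id : steerable (id : 'rV[R]_d -> 'rV[R]_d).
Proof.
have := @steerable_relu R d 0 0 0; rewrite (_ : (fun x => _) = id); last first.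
  by apply/funext => x; rewrite scaler0 addr0.
by apply; rewrite /inner big1 ?addr0// => i _; rewrite !mxE mul0r.
Qed.

Lemma borel_map_id : borel_map (id : 'rV[R]_d -> 'rV[R]_d).
Proof. by move=> i; exact: borel_coord. Qed.

Lemma transport_id : transport id id (fun=> 1).
Proof.
split=> //; try exact: steerable_id; try exact: borel_map_id.
- exact: borel_cst.
- exact: borel_cst.
- by move=> F _ _; congr lintegral; apply/funext => x; rewrite mule1.
Qed.

Lemma transport_comp Phi1 Psi1 J1 Phi2 Psi2 J2 :
  transport Phi1 Psi1 J1 -> transport Phi2 Psi2 J2 ->
  transport (Phi2 \o Phi1) (Psi1 \o Psi2) (fun y => J1 (Psi2 y) * J2 y).
Proof.
move=> t1 t2; have mJ := borel_fun_comp (transport_borelV t2) (transport_borelJ t1).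
split.
- exact: steerable_comp (transport_steer t1) (transport_steer t2).
- exact: steerable_comp (transport_steerV t2) (transport_steerV t1).
- exact: can_comp (transportK t2) (transportK t1).
- exact: can_comp (transportVK t1) (transportVK t2).
- exact: borel_map_comp (transport_borel t1) (transport_borel t2).
- exact: borel_map_comp (transport_borelV t2) (transport_borelV t1).
- by apply: borelM => //; exact: transport_borelJ t2.
- rewrite (_ : (fun y => _) = (fun y => (J1 (Psi2 y))^-1 * (J2 y)^-1)).
    apply: borelM (transport_borelJV t2).
    exact: (borel_fun_comp (transport_borelV t2) (transport_borelJV t1)).
  by apply/funext => y; rewrite invfM.
- by move=> y; rewrite mulr_gt0// ?(transport_gt0 t1) ?(transport_gt0 t2).
move=> F mF F0; rewrite (transport_change t1 (F := F \o Phi2)) => [|| x] //=.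
  rewrite (_ : (fun y => _) = (fun y => F y * (J1 (Psi2 y))%:E)%E \o Phi2).
    rewrite (transport_change t2) => [||y].
    - by congr lintegral; apply/funext => y; rewrite -muleA -EFinM.
    - exact: borel_efunM.
    - by rewrite mule_ge0// lee_fin ltW// (transport_gt0 t1).
  by apply/funext => y /=; rewrite (transportK t2).
exact: borel_efun_comp (transport_borel t2) mF.
Qed.

Lemma transport_inv Phi Psi J : transport Phi Psi J ->
  transport Psi Phi (fun x => (J (Phi x))^-1).
Proof.
move=> tr; have J0 := transport_gt0 tr.
have mJ := transport_borelJV tr.
split; try by case: tr.
- exact: (borel_fun_comp (transport_borel tr) mJ).
- rewrite (_ : (fun y => _) = J \o Phi).
    exact: borel_fun_comp (transport_borel tr) (transport_borelJ tr).
  by apply/funext => x /=; rewrite invrK.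
- by move=> y; rewrite invr_gt0.
move=> F mF F0.
have mFPsi := borel_efun_comp (transport_borelV tr) mF.
rewrite (_ : (fun x => _) = (fun y => F (Psi y) * ((J y)^-1)%:E)%E \o Phi).
  rewrite (transport_change tr) => [||y].
  - congr lintegral; apply/funext => y /=.
    by rewrite -muleA -EFinM mulVf ?mule1 ?gt_eqF.
  - exact: borel_efunM mFPsi mJ.
  - by rewrite mule_ge0// lee_fin invr_ge0 ltW.
by apply/funext => x /=; rewrite (transportK tr).
Qed.

End Transport.

(** * Approximate reachability; shears and half-line dilations *)

Section Reach.
Variables (R : realType) (d : nat).
Implicit Types (rho : 'rV[R]_d -> R) (F : 'rV[R]_d -> \bar R).

(** Finite mass instead of mass 1, since the L^1 approximations below do not keep the
    normalisation. *)
Definition density rho :=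
  [/\ borel_fun rho, forall x, 0 <= rho x &
   (lintegral (fun x => (rho x)%:E) < +oo)%E].

Definition reach_within (e : R) rho rho' := exists Phi Psi J,
  transport Phi Psi J /\ (L1dist (push Psi J rho) rho' <= e%:E)%E.

Lemma reach_within_L1 (e : R) rho rho' :
  (L1dist rho rho' <= e%:E)%E -> reach_within e rho rho'.
Proof.
move=> h; exists id, id, (fun=> 1); split; first exact: transport_id.
by rewrite (_ : push _ _ _ = rho)//; apply/funext => x; rewrite /push mulr1.
Qed.

Lemma reach_within_push (e : R) rho Phi Psi J : 0 <= e ->
  transport Phi Psi J -> reach_within e rho (push Psi J rho).
Proof. by move=> e0 tr; exists Phi, Psi, J; rewrite L1distxx lee_fin. Qed.

Lemma reach_within_sym (e : R) rho rho' : borel_fun rho -> borel_fun rho' ->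
  reach_within e rho rho' -> reach_within e rho' rho.
Proof.
move=> m m' [Phi [Psi [J [tr h]]]].
exists Psi, Phi, (fun x => (J (Phi x))^-1); split; first exact: transport_inv.
rewrite -(L1dist_push tr)//; last exact: borel_push (transport_inv tr) _.
rewrite L1distC (_ : push Psi J (push _ _ _) = rho')//.
apply/funext => y; rewrite /push (transportVK tr) mulfVK//.
by rewrite gt_eqF// (transport_gt0 tr).
Qed.

Lemma reach_within_trans (e1 e2 : R) rho1 rho2 rho3 :
  borel_fun rho1 -> borel_fun rho2 -> borel_fun rho3 ->
  reach_within e1 rho1 rho2 -> reach_within e2 rho2 rho3 ->
  reach_within (e1 + e2) rho1 rho3.
Proof.
move=> m1 m2 m3 [Phi1 [Psi1 [J1 [t1 h1]]]] [Phi2 [Psi2 [J2 [t2 h2]]]].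
exists (Phi2 \o Phi1), (Psi1 \o Psi2), (fun y => J1 (Psi2 y) * J2 y).
split; first exact: transport_comp.
rewrite (_ : push _ _ _ = push Psi2 J2 (push Psi1 J1 rho1)); last first.
  by apply/funext => y; rewrite /push /= mulrA.
have mp1 := borel_push t1 m1; have mp2 := borel_push t2 m2.
apply: (le_trans (L1dist_triangle (borel_push t2 mp1) mp2 m3)).
by rewrite EFinD leeD// (L1dist_push t2).
Qed.

Definition reach rho rho' := forall e, 0 < e -> reach_within e rho rho'.

Lemma reach_refl rho : reach rho rho.
Proof. by move=> e e0; apply: reach_within_L1; rewrite L1distxx lee_fin ltW. Qed.

Lemma reach_trans rho2 rho1 rho3 :
  borel_fun rho1 -> borel_fun rho2 -> borel_fun rho3 ->
  reach rho1 rho2 -> reach rho2 rho3 -> reach rho1 rho3.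
Proof.
move=> m1 m2 m3 h1 h2 e e0; rewrite [e]splitr.
by apply: (reach_within_trans m1 m2 m3); [apply: h1|apply: h2]; rewrite divr_gt0.
Qed.

Lemma reach_push rho Phi Psi J : transport Phi Psi J -> reach rho (push Psi J rho).
Proof. by move=> tr e /ltW e0; exact: reach_within_push e0 tr. Qed.

Lemma density_push rho Phi Psi J : transport Phi Psi J -> density rho ->
  density (push Psi J rho).
Proof.
move=> tr [m p f]; split; first exact: borel_push tr m.
  by move=> x; rewrite mulr_ge0// ltW// (transport_gt0 tr).
by move: f; rewrite -(lintegral_push tr)//; exact/borel_efunP.
Qed.

(** Dominated convergence with [rho] as dominating function. It serves for the slabs on which a ramp
    differs from a step and for the complements of growing boxes. *)
Lemma lintegral_vanish rho (B : nat -> 'rV[R]_d -> bool) : density rho ->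
  (forall n, borel_fun (fun x => (B n x)%:R)) ->
  (forall x, \forall n \near \oo, ~~ B n x) ->
  forall e, 0 < e ->
    exists n, (lintegral (fun x => ((B n x)%:R * rho x)%:E) <= e%:E)%E.
Proof.
move=> [m p f] mB B0 e e0.
pose r (u : d.-tuple R) := rho (rV_of_tuple u).
pose fn n (u : d.-tuple R) : \bar R := ((B n (rV_of_tuple u))%:R * r u)%:E.
have mfn n : measurable_fun setT (fn n).
  by apply/measurable_EFinP; exact: (borelM (mB n) m).
have mr : measurable_fun setT (fun u => (r u)%:E) by apply/measurable_EFinP; exact: m.
have [||||_ _] := @dominated_convergence _ _ R (leb R d) setT measurableT fn
   (fun=> 0%E) (fun u => (r u)%:E) mfn.
- exact: measurable_cst.
- apply: aeW => u _; apply: cvg_near_cst.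
  have := B0 (rV_of_tuple u); apply: filterS => n /negbTE Bn.
  by rewrite /fn Bn mul0r.
- apply/integrableP; split=> //.
  under eq_integral do rewrite gee0_abs ?lee_fin ?p//.
  by move: f; rewrite lintegralE//; exact/borel_efunP.
- apply: aeW => u n _; rewrite /fn gee0_abs lee_fin ?mulr_ge0 ?p//.
  by rewrite ler_piMl ?p//; case: (B n _); rewrite ?ler01.
rewrite integral0 => h.
have e0E : (0 < e%:E :> \bar R)%E by rewrite lte_fin.
have [N _ /(_ N (leqnn N)) /= hN] := h _ (open_ereal_lt' e0E).
exists N; apply/ltW; rewrite lintegralE//.
  by apply/borel_efunP; exact: borelM (mB N) m.
by move=> x; rewrite lee_fin mulr_ge0.
Qed.

Definition shear (i : 'I_d) (h : 'rV[R]_d -> R) x := upd i x (x 0 i + h x).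

Lemma updE (i : 'I_d) (x : 'rV[R]_d) t j : upd i x t 0 j = if j == i then t else x 0 j.
Proof. by rewrite mxE. Qed.

Lemma upd_upd (i : 'I_d) (x : 'rV[R]_d) t s : upd i (upd i x t) s = upd i x s.
Proof. by apply/rowP => j; rewrite !updE; case: (j == i). Qed.

Lemma upd_id (i : 'I_d) (x : 'rV[R]_d) : upd i x (x 0 i) = x.
Proof. by apply/rowP => j; rewrite !updE; case: eqP => // ->. Qed.

Lemma upd_delta (i : 'I_d) (x : 'rV[R]_d) t :
  upd i x (x 0 i + t) = x + t *: delta_mx 0 i.
Proof.
apply/rowP => j; rewrite !mxE /=; case: eqP => [->|_]; first by rewrite mulr1.
by rewrite mulr0 addr0.
Qed.

Lemma borel_map_upd (i : 'I_d) (g : 'rV[R]_d -> R) :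
  borel_fun g -> borel_map (fun x => upd i x (g x)).
Proof.
move=> mg j; rewrite (_ : (fun x => _) = fun x => if j == i then g x else x 0 j).
  by case: (j == i) => //; exact: borel_coord.
by apply/funext => x; rewrite updE.
Qed.

Lemma measurable_upd (i : 'I_d) x F : borel_efun F ->
  measurable_fun setT (fun t : R => F (upd i x t)).
Proof.
move=> mF; rewrite (_ : (fun t => _) =
    (F \o @rV_of_tuple R d) \o (fun t : R => tuple_of_rV (upd i x t))).
  apply: (measurableT_comp mF); apply/measurable_fun_tnthP => j.
  rewrite (_ : _ \o _ = fun t => if j == i then t else x 0 j).
    by case: (j == i); [exact: measurable_id|exact: measurable_cst].
  by apply/funext => t /=; rewrite tnth_mktuple updE.
by apply/funext => t /=; rewrite tuple_of_rVK.
Qed.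

Section shear_lemmas.
Variables (i : 'I_d) (h : 'rV[R]_d -> R).
Hypothesis mh : borel_fun h.
Hypothesis hi : forall x t, h (upd i x t) = h x.

Lemma borel_map_shear : borel_map (shear i h).
Proof. by apply: borel_map_upd; apply: borelD mh; exact: borel_coord. Qed.

Lemma shear_comp (k : 'rV[R]_d -> R) (x : 'rV[R]_d) :
  shear i h (shear i k x) = shear i (fun x => h x + k x) x.
Proof. by rewrite /shear hi upd_upd updE eqxx addrAC addrA. Qed.

Lemma lintegral_shear F : borel_efun F -> (forall x, 0 <= F x)%E ->
  lintegral (F \o shear i h) = lintegral F.
Proof.
move=> mF F0; apply: (lintegral_fiber (i := i)) => //.
- exact: borel_efun_comp borel_map_shear mF.
- by move=> x /=.
move=> x; apply: etrans (integral_shift (h x) (measurable_upd i x mF) (fun t => F0 _)).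
by apply: eq_integral => t _ /=; rewrite /shear upd_upd updE eqxx hi.
Qed.

End shear_lemmas.

Lemma transport_shear (i : 'I_d) (h : 'rV[R]_d -> R) : borel_fun h ->
  (forall x t, h (upd i x t) = h x) ->
  steerable (shear i h) -> steerable (shear i (fun x => - h x)) ->
  transport (shear i h) (shear i (fun x => - h x)) (fun=> 1).
Proof.
move=> mh hi sh shV.
have mhV := borel_opp mh.
split=> //.
- move=> x; rewrite shear_comp => [|y t]; last by rewrite hi.
  by rewrite /shear addNr addr0 upd_id.
- by move=> x; rewrite shear_comp// /shear addrN addr0 upd_id.
- exact: borel_map_shear.
- exact: borel_map_shear.
- exact: borel_cst.
- exact: borel_cst.
- move=> F mF F0; rewrite lintegral_shear//.
  by congr lintegral; apply/funext => x; rewrite mule1.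
Qed.

Lemma inner_delta (j : 'I_d) (x : 'rV[R]_d) : inner (delta_mx 0 j) x = x 0 j.
Proof.
rewrite /inner (bigD1 j)//= mxE !eqxx mul1r big1 ?addr0// => k kj.
by rewrite mxE eqxx (negbTE kj) mul0r.
Qed.

Lemma inner0l (a : 'rV[R]_d) : inner 0 a = 0.
Proof. by rewrite /inner big1// => k _; rewrite mxE mul0r. Qed.

Lemma steerable_shift (i : 'I_d) (v : R) : steerable (shear i (fun=> v)).
Proof.
have := @steerable_relu R d 0 (v *: delta_mx 0 i) 1.
rewrite (_ : (fun x => _) = shear i (fun=> v)).
  by apply; rewrite inner0l addr0.
apply/funext => x; rewrite /shear upd_delta inner0l add0r /relu max_l//.
by rewrite scale1r.
Qed.

(** As [j != i], the vectors [a] and [w] are orthogonal, so the slope [v] is unrestricted in sign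
    and size; [reach_step] lets it tend to infinity. *)
Lemma steerable_relu_shear (i j : 'I_d) (v c : R) : j != i ->
  steerable (shear i (fun x => v * relu (x 0 j - c))).
Proof.
move=> ji; have := @steerable_relu R d (delta_mx 0 j) (v *: delta_mx 0 i) (- c).
rewrite (_ : (fun x => _) = shear i (fun x => v * relu (x 0 j - c))).
  apply; rewrite inner_scaler inner_delta mxE eqxx /= (negbTE ji) mulr0 addr0//.
apply/funext => x; rewrite /shear upd_delta inner_delta scalerA.
by rewrite mulrC.
Qed.

Definition dilation (i : 'I_d) (c s : R) x :=
  upd i x (x 0 i + (s - 1) * relu (x 0 i - c)).

(** The ReLU map with [a] the basis vector and [w] its multiple by [s - 1], for which
    [1 + inner a w] is exactly [s]. *)
Lemma steerable_dilation (i : 'I_d) (c s : R) : 0 < s -> steerable (dilation i c s).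
Proof.
move=> s0; have := @steerable_relu R d (delta_mx 0 i) ((s - 1) *: delta_mx 0 i) (- c).
rewrite (_ : (fun x => _) = dilation i c s).
  by apply; rewrite inner_scaler inner_delta mxE !eqxx mulr1 addrC subrK.
apply/funext => x; rewrite /dilation upd_delta inner_delta scalerA.
by rewrite mulrC.
Qed.

Lemma borel_map_dilation (i : 'I_d) (c s : R) : borel_map (dilation i c s).
Proof.
have mi : borel_fun (fun x : 'rV[R]_d => x 0 i) by exact: borel_coord.
apply: borel_map_upd; apply: (borelD mi); apply: (borelM (borel_cst _)).
by apply: borel_relu; exact: borelB mi (borel_cst c).
Qed.

(** The factor [s'] is tied to [s] by an equation only, so that one statement gives both
    cancellations in [transport_dilation]. *)
Lemma dilationK (i : 'I_d) (c s s' : R) : 0 < s -> s' * s = 1 ->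
  cancel (dilation i c s) (dilation i c s').
Proof.
move=> s0 ss x; rewrite /dilation upd_upd updE eqxx.
have -> : x 0 i + (s - 1) * relu (x 0 i - c) - c =
  (x 0 i - c) + relu (x 0 i - c) * (s - 1) by ring.
rewrite relu_stretch; last by rewrite addrC subrK.
rewrite (_ : _ + _ = x 0 i); first exact: upd_id.
have -> : (s' - 1) * (relu (x 0 i - c) * (1 + (s - 1))) =
  (s' * s) * relu (x 0 i - c) - s * relu (x 0 i - c) by ring.
by rewrite ss; ring.
Qed.

Lemma transport_dilation (i : 'I_d) (c s : R) : 0 < s ->
  transport (dilation i c s) (dilation i c s^-1)
    (fun y => if y 0 i < c then 1 else s^-1).
Proof.
move=> s0; have sN0 : s != 0 by rewrite gt_eqF.
have mi : borel_fun (fun x : 'rV[R]_d => x 0 i) by exact: borel_coord.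
have mJ k : borel_fun (fun y : 'rV[R]_d => if y 0 i < c then 1 else k).
  by apply: borel_if_lt => //; exact: borel_cst.
split=> //; try exact: borel_map_dilation; try (apply: steerable_dilation => //).
- by rewrite invr_gt0.
- by apply: dilationK => //; rewrite mulVf.
- by apply: dilationK; rewrite ?invr_gt0// mulfV.
- have := mJ s; congr borel_fun; apply/funext => y.
  by case: ifP; rewrite ?invr1 ?invrK.
- by move=> y; case: ifP; rewrite ?invr_gt0.
move=> F mF F0; apply: (lintegral_fiber (i := i)) => //.
- exact: borel_efun_comp (borel_map_dilation i c s) mF.
- by move=> x /=.
- exact: borel_efunM.
- by move=> x; rewrite mule_ge0// lee_fin; case: ifP; rewrite ?invr_ge0// ltW.
move=> x; have := integral_dilate c s0 (measurable_upd i x mF) (fun t => F0 (upd i x t)).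
under eq_integral => t _.
  rewrite (_ : F _ = (F \o dilation i c s) (upd i x t)); last first.
    by rewrite /= /dilation upd_upd updE eqxx.
  over.
move=> ->; apply: eq_integral => t _; by rewrite updE eqxx.
Qed.

End Reach.

(** * Shears by step functions as limits of ReLU shears *)

Section StepShear.
Variables (R : realType) (d : nat).
Implicit Types (rho : 'rV[R]_d -> R).

Lemma density_shear (i : 'I_d) (h : 'rV[R]_d -> R) rho : borel_fun h ->
  (forall x t, h (upd i x t) = h x) -> density rho -> density (rho \o shear i h).
Proof.
move=> mh hi [m p f]; split.
- exact: borel_fun_comp (borel_map_shear i mh) m.
- by move=> x /=.
- have mE : borel_efun (fun x => (rho x)%:E) by exact/borel_efunP.
  by move: f; rewrite -(lintegral_shear mh hi mE)// => x; rewrite lee_fin.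
Qed.

(* A ramp of width 1/n differs from the step only on a slab whose mass vanishes. *)
Lemma reach_step (i j : 'I_d) (c v : R) rho : j != i -> density rho ->
  reach rho (rho \o shear i (fun x => - (v * (c <= x 0 j)%R%:R))).
Proof.
move=> ji dr e e0; have [mr pr _] := dr.
have mj : borel_fun (fun x : 'rV[R]_d => x 0 j) by exact: borel_coord.
have updj (x : 'rV[R]_d) t : upd i x t 0 j = x 0 j by rewrite updE (negbTE ji).
pose k n : R := n.+1%:R.
have k0 n : 0 < k n by rewrite ltr0n.
have kN0 n : k n != 0 by rewrite gt_eqF.
(* Two opposite slopes [v * k n], switched on at [c - 1 / k n] and at [c]: their sum climbs from 0
   to [v] in between and is constant afterwards. *)
pose r1 n (x : 'rV[R]_d) := (v * k n) * relu (x 0 j - (c - (k n)^-1)).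
pose r2 n (x : 'rV[R]_d) := (- (v * k n)) * relu (x 0 j - c).
pose h n x := r1 n x + r2 n x.
pose g (x : 'rV[R]_d) := v * (c <= x 0 j)%R%:R.
pose B n (x : 'rV[R]_d) := (c - (k n)^-1 < x 0 j) && (x 0 j < c).
have mB n : borel_fun (fun x => (B n x)%:R).
  have := borelM (borel_ltb (borel_cst (c - (k n)^-1)) mj) (borel_ltb mj (borel_cst c)).
  by congr borel_fun; apply/funext => x; rewrite -natrM mulnb.
have [n hn] : exists n, (lintegral (fun x => ((B n x)%:R * rho x)%:E) <= (e / 2)%:E)%E.
  apply: lintegral_vanish => //; last by rewrite divr_gt0.
  move=> x; rewrite /B; case: (ltP (x 0 j) c) => xc; last first.
    by apply: nearW => n; rewrite andbF.
  have xc0 : 0 < c - x 0 j by rewrite subr_gt0.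
  exists (Num.truncn (c - x 0 j)^-1) => // n /= hn; rewrite andbT -leNgt.
  rewrite lerBrDr addrC -lerBrDr -[leRHS]invrK lef_pV2 ?posrE ?invr_gt0//.
  apply/ltW; apply: (lt_le_trans (truncnS_gt _)).
  by rewrite /k ler_nat ltnS.
have mrelu (s t : R) : borel_fun (fun x : 'rV[R]_d => s * relu (x 0 j - t)).
  apply: borelM; first exact: borel_cst.
  by apply: borel_relu; apply: borelB => //; exact: borel_cst.
have mh : borel_fun (h n) by apply: borelD; exact: mrelu.
have hi x t : h n (upd i x t) = h n x by rewrite /h /r1 /r2 updj.
have mg : borel_fun g.
  by apply: borelM; [exact: borel_cst|exact: borel_leb (borel_cst c) mj].
have gi x t : g (upd i x t) = g x by rewrite /g updj.
have tr : transport (shear i (h n)) (shear i (fun x => - h n x)) (fun=> 1).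
  apply: transport_shear => //.
    rewrite (_ : shear i _ = shear i (r1 n) \o shear i (r2 n)).
      by apply: steerable_comp; exact: steerable_relu_shear.
    by apply/funext => x; rewrite /= shear_comp// => y t; rewrite /r1 updj.
  rewrite (_ : shear i _ =
    shear i (fun x => (- (v * k n)) * relu (x 0 j - (c - (k n)^-1))) \o
    shear i (fun x => (v * k n) * relu (x 0 j - c))).
    by apply: steerable_comp; exact: steerable_relu_shear.
  apply/funext => x; rewrite /= shear_comp/shear; last by move=> y t; rewrite updj.
  by congr upd; rewrite /h /r1 /r2; ring.
have hg x : ~~ B n x -> h n x = g x.
  rewrite /B negb_and -!leNgt /h /r1 /r2 /g /relu; case: (leP c (x 0 j)) => xc.
    move=> _; rewrite !max_l ?subr_ge0// ?mulr1n.
      by move: (k n) (kN0 n) => kn knN0; field.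
    by apply: le_trans xc; rewrite lerBlDr lerDl invr_ge0 ltW.
  rewrite orbF -subr_le0 => xk; rewrite (max_r xk) max_r ?subr_le0 1?ltW//.
  by rewrite !mulr0 addr0.
exists (shear i (h n)), (shear i (fun x => - h n x)), (fun=> 1); split => //.
have mhV := borel_opp mh; have mgV := borel_opp mg.
have hiV x t : - h n (upd i x t) = - h n x by rewrite hi.
have giV x t : - g (upd i x t) = - g x by rewrite gi.
(* Both shears fix [x_j], hence preserve the slab. Off the slab they agree; on it the difference is
   at most the sum of the two sheared densities, each of slab mass at most [e / 2]. *)
have BE x h' : B n (shear i h' x) = B n x by rewrite /B /shear updj.
have mBr : borel_efun (fun x => ((B n x)%:R * rho x)%:E).
  by apply/borel_efunP; exact: borelM.
have Br0 x : (0 <= ((B n x)%:R * rho x)%:E)%E by rewrite lee_fin mulr_ge0.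
rewrite [e]splitr EFinD.
rewrite -[X in (_ <= X + _)%E]/((e / 2)%:E).
apply: (@le_trans _ _ (lintegral (fun x => ((B n x)%:R * rho x)%:E) +
  lintegral (fun x => ((B n x)%:R * rho x)%:E))%E); last exact: leeD.
rewrite -{1}(lintegral_shear mhV hiV mBr Br0) -(lintegral_shear mgV giV mBr Br0).
rewrite -lintegralD//=.
- apply: le_lintegral => [| |x|x]; rewrite ?lee_fin//.
  + apply: borel_L1; first exact: borel_push tr mr.
    exact: borel_fun_comp (borel_map_shear i mgV) mr.
  + apply: (emeasurable_funD (borel_efun_comp (borel_map_shear i mhV) mBr)
      (borel_efun_comp (borel_map_shear i mgV) mBr)).
  + rewrite /push mulr1 !BE /=; case: (boolP (B n x)) => [_|/hg Bx].
      rewrite !mul1r; apply: (le_trans (ler_normB _ _)).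
      by rewrite !ger0_norm.
    by rewrite /shear Bx subrr normr0 !mul0r addr0.
- exact: (borel_efun_comp (borel_map_shear i mhV) mBr).
- exact: (borel_efun_comp (borel_map_shear i mgV) mBr).
Qed.

(** For positive [m] this is the floor of [t / m] clipped to the range from 0 to [n.-1]. Clipping
    leaves finitely many jumps, which [reach_step] can produce one by one. *)
Definition stair (m n : nat) (t : R) : nat := \sum_(k < n.-1) ((k.+1 * m)%:R <= t)%R.

Lemma reach_stair (i j : 'I_d) (m n : nat) (v : R) rho : j != i -> density rho ->
  let rho' := rho \o shear i (fun x => - (v * (stair m n (x 0 j))%:R)) in
  density rho' /\ reach rho rho'.
Proof.
move=> ji dr; rewrite /stair; elim: n.-1 => [|N [dN rN]] /=.
  rewrite (_ : _ \o _ = rho); first by split=> //; exact: reach_refl.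
  by apply/funext => x /=; rewrite /shear big_ord0 mulr0 subr0 upd_id.
set rhoN := (X in density X) in dN rN.
have updj (x : 'rV[R]_d) t : upd i x t 0 j = x 0 j by rewrite updE (negbTE ji).
have rS := reach_step (N.+1 * m)%:R v ji dN.
have E : rhoN \o shear i (fun x => - (v * ((N.+1 * m)%:R <= x 0 j)%R%:R)) =
  rho \o shear i (fun x => - (v * (\sum_(k < N.+1) ((k.+1 * m)%:R <= x 0 j)%R)%N%:R)).
  apply/funext => x; rewrite /rhoN /= shear_comp; last by move=> y t; rewrite updj.
  by congr rho; rewrite /shear big_ord_recr /= natrD mulrDr opprD.
have dS : density (rhoN \o shear i (fun x => - (v * ((N.+1 * m)%:R <= x 0 j)%R%:R))).
  apply: density_shear => //; last by move=> x t; rewrite updj.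
  apply: borel_opp; apply: borelM; first exact: borel_cst.
  by apply: borel_leb; [exact: borel_cst|exact: borel_coord].
rewrite -E; split => //.
by case: dr dN dS => [m1 _ _] [m2 _ _] [m3 _ _]; exact: reach_trans rN rS.
Qed.

Lemma stairE (m n q : nat) (t : R) : (q < n)%N ->
  (q * m)%:R <= t < (q.+1 * m)%:R -> stair m n t = q.
Proof.
move=> qn /andP[qt tq]; rewrite /stair.
have {qn} : (q <= n.-1)%N by rewrite -ltnS (leq_trans qn)// leqSpred.
elim: n.-1 => [|N IH]; first by rewrite leqn0 => /eqP ->; rewrite big_ord0.
have E k : ((k.+1 * m)%:R <= t) = (k < q)%N.
  apply/idP/idP => [kt|kq]; last first.
    by apply: le_trans qt; rewrite ler_nat leq_mul2r kq orbT.
  rewrite ltnNge; apply/negP => qk; have := le_lt_trans kt tq.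
  by rewrite ltr_nat ltnNge leq_mul2r ltnS qk orbT.
rewrite big_ord_recr /= E leq_eqVlt => /predU1P[qN|qN].
  rewrite qN ltnSn addn1; congr _.+1.
  rewrite (eq_bigr (fun=> 1%N)) ?sum_nat_const ?card_ord ?muln1// => k _.
  by rewrite E qN ltnW// ltnS ltn_ord.
by rewrite IH// ltnNge -ltnS qN addn0.
Qed.

End StepShear.

(** * From a grid of unit cells to a multiple of the unit cube *)

Section Grid.
Variables (R : realType) (n : nat).
Local Notation d := n.+1.
Implicit Types (rho : 'rV[R]_d -> R) (m : 'I_d -> nat) (x y z : 'rV[R]_d).

Definition cellwise rho := forall x y,
  (forall i, Num.floor (x 0 i) = Num.floor (y 0 i)) -> rho x = rho y.

Definition inbox m x := forall i, 0 <= x 0 i < (m i)%:R.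

(** Strict positivity in the box is what later allows each cell to be stretched to a length equal to
    its density. *)
Definition gridpos m rho :=
  [/\ density rho, cellwise rho, forall x, inbox m x -> 0 < rho x &
   forall x, ~ inbox m x -> rho x = 0].

(** The jumps sit at integers, so the staircase sees only the integer part. *)
Lemma stair_floor (p q : nat) (s t : R) : Num.floor s = Num.floor t ->
  stair p q s = stair p q t.
Proof.
move=> st; apply: eq_bigr => k _.
by rewrite -[(_ * _)%:R]/((k.+1 * p)%N%:~R) -!floor_ge_int st.
Qed.

Lemma floor_addz (s t : R) (k : int) : Num.floor s = Num.floor t ->
  Num.floor (s + k%:~R) = Num.floor (t + k%:~R).
Proof.
by move=> st; rewrite (floorDrz s (intr_int R k)) (floorDrz t (intr_int R k)) st.
Qed.

Definition merged m (j : 'I_d) (i : 'I_d) : nat :=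
  if i == ord0 then (m ord0 * m j)%N else if i == j then 1%N else m i.

(* x_0 += m_0 floor(x_j), then x_j -= floor(x_0 / m_0). *)
Lemma merge_coordinate m (j : 'I_d) rho : j != ord0 -> (0 < m ord0)%N ->
  gridpos m rho -> exists2 rho', gridpos (merged m j) rho' & reach rho rho'.
Proof.
move=> j0 m0 [dr cr pr zr].
have [d1 r1] := reach_stair 1 (m j) (m ord0)%:R j0 dr.
have j0' : ord0 != j by rewrite eq_sym.
have [d2 r2] := reach_stair (m ord0) (m j) (-1) j0' d1.
(* [A] and [B] are the inverses of the two shears, which explains the signs: the density after both
   moves is [rho \o A \o B]. *)
pose A : 'rV[R]_d -> 'rV[R]_d :=
  shear ord0 (fun x => - ((m ord0)%:R * (stair 1 (m j) (x 0 j))%:R)).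
pose B : 'rV[R]_d -> 'rV[R]_d :=
  shear j (fun x => - (-1 * (stair (m ord0) (m j) (x 0 ord0))%:R)).
have BE y i : B y 0 i = if i == j then y 0 j + (stair (m ord0) (m j) (y 0 ord0))%:R
    else y 0 i.
  by rewrite /B /shear updE mulN1r opprK.
have AE z i : A z 0 i = if i == ord0 then
    z 0 ord0 - (m ord0)%:R * (stair 1 (m j) (z 0 j))%:R else z 0 i.
  by rewrite /A /shear updE.
(* Both staircases must return the same row number [q]. From the old box it is the integer part of
   [zj]; from the new one it is the quotient by [m ord0] of the integer part of [y_0]. *)
have boxE y : inbox m (A (B y)) <-> inbox (merged m j) y.
  pose zj := y 0 j + (stair (m ord0) (m j) (y 0 ord0))%:R.
  have Ej : A (B y) 0 j = zj by rewrite AE (negbTE j0) BE eqxx.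
  have E0 : A (B y) 0 ord0 = y 0 ord0 - (m ord0)%:R * (stair 1 (m j) zj)%:R.
    by rewrite AE eqxx !BE eqxx (negbTE j0').
  have Ei i : i != ord0 -> i != j -> A (B y) 0 i = y 0 i.
    by move=> i0 ij; rewrite AE (negbTE i0) BE (negbTE ij).
  split=> h.
    have := h j; rewrite Ej => /andP[zj0 zjm].
    have /andP[qz zq] := truncn_itv zj0.
    set q := Num.truncn zj in qz zq.
    have qm : (q < m j)%N by rewrite -(ltr_nat R); exact: le_lt_trans zjm.
    have S1 : stair 1 (m j) zj = q by apply: stairE => //; rewrite !muln1 qz zq.
    have := h ord0; rewrite E0 S1 => /andP[y00 y0m].
    have S2 : stair (m ord0) (m j) (y 0 ord0) = q.
      apply: stairE => //; rewrite !natrM -natr1; apply/andP; split; lra.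
    have yj : 0 <= y 0 j < 1.
      by move: qz zq; rewrite /zj S2 -natr1 => ? ?; apply/andP; split; lra.
    move=> i; rewrite /merged; case: eqP => [->|/eqP i0].
      have : (q.+1 * m ord0)%:R <= (m ord0 * m j)%:R :> R.
        by rewrite ler_nat mulnC leq_mul2l qm orbT.
      rewrite !natrM -natr1 => le1.
      have : 0 <= (m ord0)%:R * q%:R :> R by rewrite mulr_ge0.
      by move=> ge1; apply/andP; split; lra.
    case: eqP => [->//|/eqP ij].
    by rewrite -Ei//; exact: h.
  have := h ord0; rewrite /merged eqxx => /andP[y00 y0m].
  have /andP[ky yk] := truncn_itv y00.
  set k := Num.truncn (y 0 ord0) in ky yk.
  have km : (k < m ord0 * m j)%N by rewrite -(ltr_nat R); exact: le_lt_trans y0m.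
  pose q := (k %/ m ord0)%N.
  have qm : (q < m j)%N by rewrite ltn_divLR// mulnC.
  have qy : (q * m ord0)%:R <= y 0 ord0.
    by apply: le_trans ky; rewrite ler_nat leq_divM.
  have yq : y 0 ord0 < (q.+1 * m ord0)%:R.
    by apply: lt_le_trans yk _; rewrite ler_nat ltn_ceil.
  have S2 : stair (m ord0) (m j) (y 0 ord0) = q by apply: stairE; rewrite ?qy.
  have := h j; rewrite /merged (negbTE j0) eqxx => /andP[yj0 yj1].
  have zjE : zj = y 0 j + q%:R by rewrite /zj S2.
  have S1 : stair 1 (m j) zj = q.
    by apply: stairE => //; rewrite !muln1 zjE -natr1; apply/andP; split; lra.
  have qm' : q.+1%:R <= (m j)%:R :> R by rewrite ler_nat.
  move=> i; case: (eqVneq i ord0) => [->|i0].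
    rewrite E0 S1; move: qy yq; rewrite !natrM -natr1 => qy yq.
    by apply/andP; split; lra.
  case: (eqVneq i j) => [->|ij].
    rewrite Ej zjE; move: qm'; rewrite -natr1 => qm'.
    have q0 : 0 <= q%:R :> R by [].
    by apply/andP; split; lra.
  by rewrite Ei//; have := h i; rewrite /merged (negbTE i0) (negbTE ij).
exists (rho \o A \o B); last first.
  by case: dr d1 d2 => [? _ _] [? _ _] [? _ _]; exact: reach_trans r1 r2.
split=> //.
(* Cells go to cells: each shear adds an integer that depends only on integer parts. *)
- move=> x y xy; apply: cr => i.
  have Bf k : Num.floor (B x 0 k) = Num.floor (B y 0 k).
    rewrite !BE (stair_floor _ _ (xy ord0)); case: ifP => // _.
    exact: (floor_addz (Posz _) (xy j)).
  rewrite !AE (stair_floor _ _ (Bf j)); case: ifP => // _.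
  have -> (s t : nat) : - (s%:R * t%:R) = (- (Posz (s * t)))%:~R :> R.
    by rewrite rmorphN /= -natrM.
  exact: floor_addz (Bf ord0).
- by move=> x /boxE /pr.
- by move=> x xb /=; apply: zr => /boxE.
Qed.

Lemma merge_coordinates m rho (s : seq 'I_d) : (forall i, 0 < m i)%N ->
  ord0 \notin s -> gridpos m rho ->
  exists m' rho', [/\ (forall i, 0 < m' i)%N, forall j, j \in s -> m' j = 1%N,
    gridpos m' rho' & reach rho rho'].
Proof.
move=> m0; elim: s => [_ g|j s IH].
  by exists m, rho; split=> //; exact: reach_refl.
rewrite inE negb_or => /andP[j0 s0] g.
have [m' [rho' [m'0 m's g' r']]] := IH s0 g.
rewrite eq_sym in j0; have [rho'' g'' r''] := merge_coordinate j0 (m'0 ord0) g'.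
exists (merged m' j), rho''; split=> //.
- by move=> i; rewrite /merged; case: ifP => _; [rewrite muln_gt0 !m'0|case: ifP].
- move=> i; rewrite inE /merged; case: (eqVneq i j) => [-> _|ij] /=.
    by rewrite (negbTE j0).
  by case: (eqVneq i ord0) => [->|_ /m's//]; rewrite (negbTE s0).
- case: g g' g'' => [[? _ _] _ _ _] [[? _ _] _ _ _] [[? _ _] _ _ _].
  exact: reach_trans r' r''.
Qed.

Definition slab x : bool := [forall i : 'I_d, (i != ord0) ==> (0 <= x 0 i < 1)].

Lemma slab_upd x t : slab (upd ord0 x t) = slab x.
Proof.
by apply: eq_forallb => i; rewrite updE; case: eqP.
Qed.

(* On [0, s) the density is already normalised to 1; l lists its values on the
   unit cells that follow. *)
Definition profile (s : R) (l : seq R) (t : R) : R :=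
  if t < s then (0 <= t)%R%:R else nth 0 l (Num.truncn (t - s)).

Definition slab_density (h : R -> R) x : R := h (x 0 ord0) * (slab x)%:R.

Lemma gridpos_slab m rho : (forall j, j != ord0 -> m j = 1%N) ->
  gridpos m rho ->
  rho = slab_density (profile 0 (mkseq (fun k => rho (upd ord0 0 k%:R)) (m ord0))).
Proof.
move=> m1 [_ cr pr zr]; apply/funext => x; rewrite /slab_density /profile subr0.
case: (boolP (slab x)) => sx; last first.
  rewrite mulr0 zr// => bx; move/negP: sx; apply; apply/forallP => i.
  by apply/implyP => i0; have := bx i; rewrite m1.
rewrite mulr1; case: ltP => x0.
  by rewrite zr// => /(_ ord0) /andP[]; rewrite leNgt x0.
have /andP[kx xk] := truncn_itv x0.
case: (ltnP (Num.truncn (x 0 ord0)) (m ord0)) => km.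
  rewrite nth_mkseq//; apply: cr => i; rewrite updE.
  case: eqP => [->|/eqP i0].
    by rewrite truncn_floor x0 natr_absz ger0_norm ?floor_ge0// intrKfloor.
  rewrite mxE floor0; apply/floor_def; rewrite add0r.
  by have /forallP /(_ i) := sx; rewrite i0.
rewrite nth_default ?size_mkseq//; apply: zr => /(_ ord0) /andP[_].
by rewrite ltNge => /negP; apply; apply: le_trans kx; rewrite ler_nat.
Qed.

(** The pointwise identity behind [reach_profile_step]; [a^-1^-1] is the form in which the inverse
    of the dilation by [a^-1] arrives. Points below [s] are untouched, the cell of height [a] is
    spread over length [a] and gets height 1, and beyond [s + a] the two Jacobians cancel. *)
Lemma profile_step (s a t : R) (l : seq R) : 0 <= s -> 0 < a ->
  let t1 := t + (a^-1^-1 - 1) * relu (t - (s + a)) in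
  profile s (a :: l) (t1 + (a^-1 - 1) * relu (t1 - s)) *
    (if t1 < s then 1 else a^-1) * (if t < s + a then 1 else a^-1^-1) =
  profile (s + a) l t.
Proof.
move=> s0 a0; have aN0 : a != 0 by rewrite gt_eqF.
rewrite invrK /relu /=; case: (ltP t (s + a)) => tsa.
  rewrite (max_r (y := 0) (x := t - (s + a))) ?subr_le0 1?ltW// mulr0 addr0 mulr1.
  case: (ltP t s) => ts.
    rewrite (max_r (y := 0) (x := t - s)) ?subr_le0 1?ltW// mulr0 addr0 mulr1.
    by rewrite /profile ts tsa.
  rewrite (max_l (y := 0) (x := t - s)) ?subr_ge0//.
  have -> : t + (a^-1 - 1) * (t - s) = s + (t - s) / a by ring.
  have q0 : 0 <= (t - s) / a by rewrite divr_ge0 ?subr_ge0// ltW.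
  have q1 : (t - s) / a < 1 by rewrite ltr_pdivrMr// mul1r; lra.
  rewrite /profile ltNge lerDl q0 /= addrAC subrr add0r tsa (le_trans s0 ts).
  by rewrite (truncn_def (n := 0)) ?q0//= mulfV.
rewrite (max_l (y := 0) (x := t - (s + a))) ?subr_ge0//.
have -> : t + (a - 1) * (t - (s + a)) = s + a * (t - (s + a) + 1) by ring.
have p0 : 0 <= t - (s + a) by rewrite subr_ge0.
have q0 : 0 <= a * (t - (s + a) + 1) by exact: mulr_ge0 (ltW a0) (addr_ge0 p0 ler01).
rewrite ltNge lerDl q0 /= (addrAC s _ (- s)) subrr add0r (max_l q0).
have -> : s + a * (t - (s + a) + 1) + (a^-1 - 1) * (a * (t - (s + a) + 1)) =
  s + (t - (s + a) + 1) by field.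
have q1 : 0 <= t - (s + a) + 1 by rewrite addr_ge0.
rewrite /profile ltNge lerDl q1 /= (addrAC s _ (- s)) subrr add0r.
rewrite ltNge tsa /= -mulrA mulVf// mulr1.
rewrite (truncn_def (n := (Num.truncn (t - (s + a))).+1))//.
by rewrite -!natr1 !lerD2r !ltrD2r natr1 truncn_itv.
Qed.

(* The dilation at s stretches the first cell to length a, the one at s + a
   gives the remaining cells their unit length back. *)
Lemma reach_profile_step (s a : R) (l : seq R) : 0 <= s -> 0 < a ->
  density (slab_density (profile s (a :: l))) ->
  density (slab_density (profile (s + a) l)) /\
  reach (slab_density (profile s (a :: l))) (slab_density (profile (s + a) l)).
Proof.
move=> s0 a0 dr; have a'0 : 0 < a^-1 by rewrite invr_gt0.
have t1 := @transport_dilation R d ord0 s a a0.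
have t2 := @transport_dilation R d ord0 (s + a) a^-1 a'0.
have d1 := density_push t1 dr; have d2 := density_push t2 d1.
have r1 := reach_push (slab_density (profile s (a :: l))) t1.
have r2 := reach_push (push _ _ (slab_density (profile s (a :: l)))) t2.
set rho2 := push _ _ (push _ _ _) in d2.
suff E : rho2 = slab_density (profile (s + a) l).
  rewrite -E; split => //.
  by case: dr d1 d2 => [? _ _] [? _ _] [? _ _]; exact: reach_trans r1 (r2 _ _).
apply/funext => y.
rewrite /rho2 /push /slab_density /dilation !upd_upd !updE !eqxx !slab_upd.
by rewrite -(profile_step (y 0 ord0) l s0 a0) /= !(mulrAC _ (slab y)%:R).
Qed.

(** The [S] constructed is [s] plus the sum of [l]. The equality case is recorded because, starting
    from [s = 0] with a nonempty list, it makes the final length positive. *)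
Lemma reach_profile (s : R) (l : seq R) : 0 <= s -> all (fun a => 0 < a) l ->
  density (slab_density (profile s l)) ->
  exists2 S : R, s <= S ?= iff (l == [::]) &
  density (slab_density (profile S [::])) /\
  reach (slab_density (profile s l)) (slab_density (profile S [::])).
Proof.
elim: l s => [|a l IH] s s0 /=.
  by move=> _ dr; exists s; [exact/leif_refl|split=> //; exact: reach_refl].
move=> /andP[a0 l0] dr; have [d1 r1] := reach_profile_step s0 a0 dr.
have [|S sS [d2 r2]] := IH (s + a) _ l0 d1; first by rewrite addr_ge0// ltW.
exists S.
  apply/leifP => /=; apply: lt_le_trans (sS.1); by rewrite ltrDl.
split=> //.
by case: dr d1 d2 => [? _ _] [? _ _] [? _ _]; exact: reach_trans r1 r2.
Qed.

Definition unit_cube : 'rV[R]_d -> R := slab_density (profile 1 [::]).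

(** Dividing [x_0] by [S] turns the length of the bar into the height of the cube. *)
Lemma reach_unit_cube (S : R) : 0 < S -> density (slab_density (profile S [::])) ->
  density (fun y => S * unit_cube y) /\
  reach (slab_density (profile S [::])) (fun y => S * unit_cube y).
Proof.
move=> S0 dr; have S'0 : 0 < S^-1 by rewrite invr_gt0.
have SN0 : S != 0 by rewrite gt_eqF.
have t1 := @transport_dilation R d ord0 0 S^-1 S'0.
have d1 := density_push t1 dr.
have r1 := reach_push (slab_density (profile S [::])) t1.
set rho1 := push _ _ _ in d1 r1.
suff E : rho1 = (fun y => S * unit_cube y) by rewrite -E.
apply/funext => y.
rewrite /rho1 /push /unit_cube /slab_density /dilation !updE !eqxx !slab_upd invrK.
rewrite mulrA mulrAC; congr (_ * _); rewrite /profile subr0 /relu.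
case: (ltP (y 0 ord0) 0) => y0.
  rewrite mulr0 addr0 (lt_trans y0 S0) (lt_trans y0 ltr01).
  by rewrite leNgt y0 /= mul0r mulr0.
have -> : y 0 ord0 + (S - 1) * y 0 ord0 = S * y 0 ord0 by ring.
rewrite gtr_pMr// mulr_ge0// 1?ltW// !nth_nil.
by case: ifP; rewrite ?mul0r ?mulr0// mul1r mulr1.
Qed.

Lemma gridpos_reach m rho : (forall i, 0 < m i)%N -> gridpos m rho ->
  exists2 S : R, 0 < S & density (fun y => S * unit_cube y) /\
    reach rho (fun y => S * unit_cube y).
Proof.
move=> m0 g; pose s := [seq i <- enum 'I_d | i != ord0].
have s0 : ord0 \notin s by rewrite mem_filter eqxx.
have [m' [rho' [m'0 m's g' r']]] := merge_coordinates m0 s0 g.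
have m1 j : j != ord0 -> m' j = 1%N.
  by move=> j0; apply: m's; rewrite mem_filter j0 mem_enum.
have E := gridpos_slab m1 g'.
set l := mkseq _ _ in E.
have l0 : all (fun a => 0 < a) l.
  apply/allP => _ /mapP[k + ->]; rewrite mem_iota add0n => /andP[_ km].
  case: g' => _ _ pr _; apply: pr => i; rewrite updE; case: eqP => [->|/eqP i0].
    by rewrite ler0n ltr_nat.
  by rewrite mxE lexx m1// ltr01.
have [g1 _ _ _] := g'; rewrite E in g1.
have [S S0 [d2 r2]] := reach_profile (lexx 0) l0 g1.
have {}S0 : 0 < S.
  by rewrite (lt_leif S0) -size_eq0 size_mkseq -lt0n m'0.
have [d3 r3] := reach_unit_cube S0 d2.
exists S => //; split=> //; rewrite -E in g1 r2.
case: g => -[b1 _ _] _ _ _; case: g1 d2 d3 => [b2 _ _] [b3 _ _] [b4 _ _].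
by apply: (reach_trans b1 b3 b4 _ r3); exact: (reach_trans b1 b2 b3 r' r2).
Qed.

End Grid.

(** * Bringing a grid of arbitrary mesh and position to unit cells *)

Section AffineGrid.
Variables (R : realType) (n : nat).
Local Notation d := n.+1.
Implicit Types (rho : 'rV[R]_d -> R) (m : 'I_d -> nat) (x y z : 'rV[R]_d).
Implicit Types (o c : 'I_d -> R).

Definition rescale o c x : 'rV[R]_d := \row_i (c i * (x 0 i + o i)).

(** For positive [c], the grid starts at the corner [- o] and its cells have sides [1 / c i];
    [rescale] maps them to unit cells at the origin. *)
Definition affine_gridpos o c m rho :=
  [/\ density rho,
   forall x y, (forall i, Num.floor (rescale o c x 0 i) =
     Num.floor (rescale o c y 0 i)) -> rho x = rho y,
   forall x, inbox m (rescale o c x) -> 0 < rho x &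
   forall x, ~ inbox m (rescale o c x) -> rho x = 0].

(** A half-line dilation can stand in for a linear one: after the shift by [o j] the density
    vanishes where [x_j < 0], the side that the dilation leaves alone. *)
Lemma normalize_coordinate o c m (j : 'I_d) rho : 0 < c j ->
  affine_gridpos o c m rho -> exists2 rho',
    affine_gridpos (fun i => if i == j then 0 else o i)
      (fun i => if i == j then 1 else c i) m rho' & reach rho rho'.
Proof.
move=> cj [dr cr pr zr].
have t1 := @transport_shear R d j (fun=> o j) (borel_cst _) (fun _ _ => erefl)
  (steerable_shift j (o j)) (steerable_shift j (- o j)).
have t2 := @transport_dilation R d j 0 (c j) cj.
have d1 := density_push t1 dr; have d2 := density_push t2 d1.
have r1 := reach_push rho t1.
have r2 := reach_push (push _ _ rho) t2.
set rho2 := push _ _ (push _ _ _) in d2.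
pose back y := upd j y (y 0 j + ((c j)^-1 - 1) * relu (y 0 j - 0) - o j).
pose jac y := if y 0 j < 0 then 1 else (c j)^-1.
have jac0 y : 0 < jac y by rewrite /jac; case: ifP; rewrite ?invr_gt0.
have E y : rho2 y = rho (back y) * jac y.
  by rewrite /rho2 /push mulr1 /back /shear /dilation upd_upd updE eqxx.
set o' := fun i => if i == j then 0 else o i.
set c' := fun i => if i == j then 1 else c i.
have Rj y : rescale o c (back y) 0 j = if y 0 j < 0 then c j * y 0 j else y 0 j.
  rewrite !mxE eqxx subrK /relu subr0; case: ltP => y0.
    by rewrite mulr0 addr0.
  by field; rewrite gt_eqF.
have R'j y : rescale o' c' y 0 j = y 0 j.
  by rewrite mxE /o' /c' eqxx addr0 mul1r.
have Ri y i : i != j -> rescale o c (back y) 0 i = rescale o' c' y 0 i.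
  by move=> ij; rewrite !mxE /o' /c' (negbTE ij).
have boxE y : inbox m (rescale o c (back y)) <-> inbox m (rescale o' c' y).
  have jE (M : R) : (0 <= rescale o c (back y) 0 j < M) =
      (0 <= rescale o' c' y 0 j < M).
    rewrite Rj R'j; case: (ltP (y 0 j) 0) => y0; last by rewrite ?y0.
    by rewrite pmulr_rge0// ?(lt_geF y0).
  split=> h i; have := h i; (have [->|ij] := eqVneq i j; last by rewrite Ri);
    by rewrite jE.
exists rho2; last first.
  by case: dr d1 d2 => [? _ _] [? _ _] [? _ _]; exact: reach_trans r1 (r2 _ _).
split=> //.
- move=> x y xy; rewrite !E; have := xy j; rewrite !R'j => xyj.
  have sgn : (x 0 j < 0) = (y 0 j < 0).
    by rewrite !ltNge -(floor_ge0 (x 0 j)) -(floor_ge0 (y 0 j)) xyj.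
  (* On the undilated side the old and new cells do not match, but the density is zero at both
     points. *)
  case: (ltP (x 0 j) 0) => x0.
    have off z : z 0 j < 0 -> rho (back z) = 0.
      move=> z0; apply: zr => /boxE /(_ j); rewrite R'j => /andP[].
      by rewrite leNgt z0.
    by rewrite !off -?sgn// !mul0r.
  congr (_ * _); last by rewrite /jac sgn.
  apply: cr => i; have [->|ij] := eqVneq i j; last by rewrite !Ri.
  by rewrite !Rj -sgn ltNge x0.
- by move=> x /boxE /pr; rewrite E => ?; rewrite mulr_gt0.
- by move=> x xb; rewrite E zr ?mul0r// => /boxE.
Qed.

Lemma affine_gridpos_reach o c m rho : (forall i, 0 < c i) ->
  affine_gridpos o c m rho -> exists2 rho', gridpos m rho' & reach rho rho'.
Proof.
move=> c0 g.
suff H (s : seq 'I_d) : exists p' c' rho', [/\ forall i, 0 < c' i,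
    forall i, i \in s -> p' i = 0 /\ c' i = 1,
    affine_gridpos p' c' m rho' & reach rho rho'].
  have [p' [c' [rho' [_ s1 [dr cr pr zr] r']]]] := H (enum 'I_d).
  exists rho' => //.
  have E x : rescale p' c' x = x.
    apply/rowP => i; rewrite mxE.
    by have [-> ->] := s1 i (mem_enum _ i); rewrite addr0 mul1r.
  by split=> // [x y|x|x]; [have := cr x y|have := pr x|have := zr x]; rewrite !E.
elim: s => [|j s [p' [c' [rho' [c'0 s1 g' r']]]]].
  by exists o, c, rho; split=> //; exact: reach_refl.
have [rho'' g'' r''] := normalize_coordinate (c'0 j) g'.
exists (fun i => if i == j then 0 else p' i).
exists (fun i => if i == j then 1 else c' i), rho''.
split=> //.
- by move=> i; case: ifP.
- by move=> i; rewrite inE; case: eqP => //= _; exact: s1.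
- case: g g' g'' => [[? _ _] _ _ _] [[? _ _] _ _ _] [[? _ _] _ _ _].
  exact: reach_trans r' r''.
Qed.

End AffineGrid.

(** * Approximating Borel sets by unions of grid cells *)

Section GridSets.
Variables (R : realType) (d : nat).
Local Notation T := (d.-tuple R).
Local Notation mu := (leb R d).
Implicit Types (A G : set T) (N : nat).

Lemma floor_coarse (k : nat) (a b : R) :
  Num.floor (k.+1%:R * a) = Num.floor (k.+1%:R * b) -> Num.floor a = Num.floor b.
Proof.
have le_ (s t : R) : Num.floor (k.+1%:R * s) = Num.floor (k.+1%:R * t) ->
    Num.floor s <= Num.floor t.
  move=> st; rewrite floor_ge_int -(ler_pM2l (ltr0Sn R k)).
  rewrite -[k.+1%:R]/((Posz k.+1)%:~R) -intrM -floor_ge_int.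
  rewrite -[(Posz k.+1)%:~R]/(k.+1%:R : R) -st floor_ge_int intrM.
  by rewrite ler_pM2l ?ltr0Sn// floor_le.
by move=> ab; apply/le_anti; rewrite !le_.
Qed.

Definition same_cell N (u v : T) := forall i,
  Num.floor (N.+1%:R * tnth u i) = Num.floor (N.+1%:R * tnth v i).

(** A common refinement of two grids; the predecessor compensates the successor built into
    [same_cell]. *)
Lemma same_cell_mul N1 N2 (u v : T) :
  same_cell (N1.+1 * N2.+1).-1 u v -> same_cell N1 u v /\ same_cell N2 u v.
Proof.
rewrite /same_cell prednK ?muln_gt0// => h; split=> i; have := h i.
  by rewrite mulnC natrM -!mulrA; exact: floor_coarse.
by rewrite natrM -!mulrA; exact: floor_coarse.
Qed.

Definition gridset N G :=
  measurable G /\ forall u v, same_cell N u v -> G u -> G v.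

Definition symdiff A G := (A `\` G) `|` (G `\` A).

Lemma measurable_symdiff A G : measurable A -> measurable G ->
  measurable (symdiff A G).
Proof. by move=> mA mG; apply: measurableU; exact: measurableD. Qed.

Section fixed_domain.
Variable E : set T.
Hypotheses (mE : measurable E) (Efin : (mu E < +oo)%E).

(** Chosen so that these sets form a sigma-algebra containing the coordinate rays, and therefore all
    Borel sets. *)
Definition grid_approx A := measurable A /\ forall e : R, 0 < e ->
  exists N G, gridset N G /\ (mu (E `&` symdiff A G) <= e%:E)%E.

Lemma grid_approx_gridset N G : gridset N G -> grid_approx G.
Proof.
move=> gG; split=> [|e e0]; first by case: gG.
exists N, G; split=> //.
by rewrite /symdiff setDv setU0 setI0 measure0 lee_fin ltW.
Qed.

Lemma grid_approx0 : grid_approx set0.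
Proof. by apply: (@grid_approx_gridset 0%N); split. Qed.

Lemma gridsetC N G : gridset N G -> gridset N (~` G).
Proof.
move=> [mG gG]; split=> [|u v uv nGu Gv]; first exact: measurableC.
by apply: nGu; apply: gG Gv => i; rewrite uv.
Qed.

Lemma grid_approxC A : grid_approx A -> grid_approx (~` A).
Proof.
move=> [mA hA]; split=> [|e e0]; first exact: measurableC.
have [N [G [gG GA]]] := hA e e0; exists N, (~` G); split; first exact: gridsetC.
rewrite (_ : symdiff (~` A) (~` G) = symdiff A G)//.
by rewrite /symdiff !setDE !setCK setUC setIC [in X in _ `|` X]setIC.
Qed.

Lemma grid_approxU A B : grid_approx A -> grid_approx B -> grid_approx (A `|` B).
Proof.
move=> [mA hA] [mB hB]; split=> [|e e0]; first exact: measurableU.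
have e2 : 0 < e / 2 by rewrite divr_gt0.
have [N1 [G1 [[mG1 g1] h1]]] := hA _ e2.
have [N2 [G2 [[mG2 g2] h2]]] := hB _ e2.
exists (N1.+1 * N2.+1).-1, (G1 `|` G2); split.
  split=> [|u v /same_cell_mul[uv1 uv2]]; first exact: measurableU.
  by move=> [/(g1 _ _ uv1)|/(g2 _ _ uv2)]; [left|right].
have m1 : measurable (E `&` symdiff A G1).
  by apply: measurableI => //; exact: measurable_symdiff.
have m2 : measurable (E `&` symdiff B G2).
  by apply: measurableI => //; exact: measurable_symdiff.
rewrite [e]splitr EFinD.
apply: (@le_trans _ _ (mu (E `&` symdiff A G1) + mu (E `&` symdiff B G2))%E); last first.
  exact: leeD.
apply: le_trans (measureU2 _ m1 m2).
apply: le_measure; rewrite ?inE; [|exact: measurableU|].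
  apply: measurableI => //; apply: measurable_symdiff; exact: measurableU.
move=> u [Eu [[[Au|Bu] nG]|[[Gu|Gu] nA]]].
- by left; split=> //; left; split=> // Gu; apply: nG; left.
- by right; split=> //; left; split=> // Gu; apply: nG; right.
- by left; split=> //; right; split=> // Au; apply: nA; left.
- by right; split=> //; right; split=> // Bu; apply: nA; right.
Qed.

(** Finite measure of [E] enters here: what the first [K] sets miss of the union decreases to the
    empty set, so its measure in [E] tends to 0 and a finite union can be approximated instead. *)
Lemma grid_approx_bigcup (F : (set T)^nat) :
  (forall k, grid_approx (F k)) -> grid_approx (\bigcup_k F k).
Proof.
move=> hF; have mF k : measurable (F k) by case: (hF k).
have mU : measurable (\bigcup_k F k) by exact: bigcupT_measurable.
split=> // e e0; have e2 : 0 < e / 2 by rewrite divr_gt0.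
pose B K := \big[setU/set0]_(k < K) F k.
have hB K : grid_approx (B K).
  rewrite /B; elim: K => [|K IH]; first by rewrite big_ord0; exact: grid_approx0.
  by rewrite big_ord_recr; exact: grid_approxU.
pose D K := E `&` (\bigcup_k F k `\` B K).
have mD K : measurable (D K).
  by apply: measurableI => //; apply: measurableD => //; case: (hB K).
have capD : \bigcap_K D K = set0.
  apply/seteqP; split=> // u Du.
  have [_ [[k _ Fku] _]] := Du 0%N I.
  have [_ [_]] := Du k.+1 I; apply.
  by rewrite /B big_ord_recr; right.
have := @nonincreasing_cvg_mu _ _ _ mu D; rewrite capD measure0 => cvgD.
have e2E : (0 < (e / 2)%:E :> \bar R)%E by rewrite lte_fin.
have [||||K _ /(_ K (leqnn K)) /= hK] := cvgD _ _ _ _ _ (open_ereal_lt' e2E) => //.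
- apply: le_lt_trans Efin; apply: le_measure; rewrite ?inE//; exact: subIsetl.
- move=> p q pq; apply/subsetPset => u [Eu [Fu nB]]; split=> //; split=> //.
  by apply: contra_not nB; exact: (subset_bigsetU pq).
have [N [G [[mG gG] hG]]] := (hB K).2 _ e2.
exists N, G; split=> //.
have mBG : measurable (E `&` symdiff (B K) G).
  by apply: measurableI => //; apply: measurable_symdiff => //; case: (hB K).
rewrite [e]splitr EFinD.
apply: (@le_trans _ _ (mu (D K) + mu (E `&` symdiff (B K) G))%E); last first.
  by apply: leeD => //; exact: ltW.
apply: le_trans (measureU2 _ (mD K) mBG).
apply: le_measure; rewrite ?inE; [|exact: measurableU|].
  by apply: measurableI => //; exact: measurable_symdiff.
move=> u [Eu [[Fu nG]|[Gu nF]]].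
  have [Bu|nB] := pselect (B K u); last by left.
  by right; split=> //; left.
right; split=> //; right; split=> // Bu; apply: nF.
by move: Bu; rewrite /B -bigcup_mkord => -[k _ Fk]; exists k.
Qed.

Lemma sigma_algebra_grid_approx : sigma_algebra setT grid_approx.
Proof.
split; [exact: grid_approx0| |exact: grid_approx_bigcup].
by move=> A; rewrite setTD; exact: grid_approxC.
Qed.

(** The ray is a countable union of closed rays starting at grid points: [q N] is the first integer
    strictly above [N.+1 * x], and these starting points come arbitrarily close to [x]. *)
Lemma grid_approx_ray (i : 'I_d) (x : R) :
  grid_approx [set u | x < tnth u i].
Proof.
pose q N : int := Num.floor (N.+1%:R * x) + 1.
have -> : [set u | x < tnth u i] =
    \bigcup_N [set u : T | (q N)%:~R <= N.+1%:R * tnth u i].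
  apply/seteqP; split=> u /=; last first.
    move=> [N _ /=] h; rewrite -(ltr_pM2l (ltr0Sn R N)).
    by apply: lt_le_trans h; rewrite /q floorD1_gt.
  move=> xu; have xu0 : 0 < tnth u i - x by rewrite subr_gt0.
  pose N := Num.truncn (tnth u i - x)^-1; exists N => //=.
  have h : 1 <= N.+1%:R * (tnth u i - x).
    by rewrite -ler_pdivrMr// mul1r; apply/ltW/truncnS_gt.
  rewrite /q intrD; have := floor_le (N.+1%:R * x).
  by rewrite mulrBr in h; lra.
apply: grid_approx_bigcup => N; apply: (@grid_approx_gridset N); split.
  have mt : measurable_fun setT (fun u : T => N.+1%:R * tnth u i).
    by apply: measurable_funM => //; exact: measurable_tnth.
  rewrite -[X in measurable X]setTI.
  rewrite (_ : [set u | _] = (fun u : T => N.+1%:R * tnth u i) @^-1` `[(q N)%:~R, +oo[).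
    by apply: mt.
  by apply/seteqP; split=> u /=; rewrite in_itv /= andbT.
by move=> u v uv /=; rewrite -!floor_ge_int (uv i).
Qed.

Lemma measurable_grid_approx A : measurable A -> grid_approx A.
Proof.
apply: smallest_sub; first exact: sigma_algebra_grid_approx.
(* The sigma-algebra on tuples is generated by coordinate preimages and that of the line by open
   rays, so the rays above suffice. *)
move=> B; rewrite -bigcup_seq => -[i _ [C mC <-]].
have {mC} : (@RGenOInfty.G R).-sigma.-measurable C.
  by rewrite -RGenOInfty.measurableE.
apply: (smallest_sub (sigma_algebra_image _ sigma_algebra_grid_approx)).
move=> _ [x ->]; rewrite /image_set_system /= setTI.
have := grid_approx_ray i x; congr grid_approx.
by apply/seteqP; split=> u /=; rewrite in_itv /= andbT.
Qed.

End fixed_domain.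

End GridSets.

(** * Approximating integrable functions by functions constant on cells *)

Section GridFunctions.
Import HBSimple.
Variables (R : realType) (d : nat).
Local Notation T := (d.-tuple R).
Local Notation mu := (leb R d).

Definition gridfun N (g : T -> R) :=
  measurable_fun setT g /\ forall u v, same_cell N u v -> g u = g v.

Lemma measurable_L1 (D : set T) (f g : T -> R) :
  measurable_fun D f -> measurable_fun D g ->
  measurable_fun D (fun u => `|f u - g u|%:E).
Proof.
move=> mf mg; apply/measurable_EFinP.
by apply: (measurableT_comp (@normr_measurable R setT)); exact: measurable_funB.
Qed.

Lemma measurable_indicT (G : set T) : measurable G ->
  measurable_fun setT (fun u => \1_G u : R).
Proof. by move=> mG; exact: (measurable_indic mG). Qed.

Lemma measurable_mul_indic (r : R) (G : set T) : measurable G ->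
  measurable_fun setT (fun u => r * \1_G u).
Proof. by move=> mG; apply: measurable_funM => //; exact: measurable_indicT. Qed.

Lemma sum_indic_grid_approx (E : set T) (A : R -> set T) (rs : seq R) (e : R) :
  measurable E -> (mu E < +oo)%E -> (forall r, measurable (A r)) -> 0 < e ->
  exists N g, gridfun N g /\
    (\int[mu]_(u in E) `|\sum_(r <- rs) r * \1_(A r) u - g u|%:E <= e%:E)%E.
Proof.
move=> mE Efin mA; elim: rs e => [|r rs IH] e e0.
  exists 0%N, (fun=> 0); split; first by split=> //; exact: measurable_cst.
  rewrite integral0_eq ?lee_fin ?ltW// => u _.
  by rewrite big_nil subr0 normr0.
have e2 : 0 < e / 2 by rewrite divr_gt0.
have [N1 [g [[mg gg] hg]]] := IH _ e2.
(* The error on the level set is multiplied by the absolute value of [r]; the added 1 covers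
   [r = 0]. *)
pose e' := e / 2 / (`|r| + 1).
have r1 : 0 < `|r| + 1 by rewrite ltr_wpDl.
have e'0 : 0 < e' by rewrite divr_gt0.
have [N2 [G [[mG gG] hG]]] := (measurable_grid_approx mE Efin (mA r)).2 _ e'0.
exists (N1.+1 * N2.+1).-1, (fun u => r * \1_G u + g u); split.
  split=> [|u v /same_cell_mul[uv1 uv2]].
    by apply: measurable_funD => //; exact: measurable_mul_indic.
  rewrite (gg _ _ uv1) !indicE; congr (_ * _%:R + _).
  have uvG : G u <-> G v by split; apply: gG => // i; rewrite uv2.
  by congr nat_of_bool; apply/idP/idP; rewrite !inE => /uvG.
have msum : measurable_fun setT (fun u => \sum_(r <- rs) r * \1_(A r) u).
  by apply: measurable_sum => s; exact: measurable_mul_indic.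
have msd : measurable (symdiff (A r) G) by exact: measurable_symdiff.
apply: (@le_trans _ _ (\int[mu]_(u in E) (`|r|%:E * (\1_(symdiff (A r) G) u)%:E +
    `|\sum_(r <- rs) r * \1_(A r) u - g u|%:E))%E).
  apply: ge0_le_integral => //.
  - apply: measurable_funTS; apply: measurable_L1.
      under eq_fun do rewrite big_cons.
      by apply: measurable_funD => //; exact: measurable_mul_indic.
    by apply: measurable_funD => //; exact: measurable_mul_indic.
  - apply: measurable_funTS; apply: emeasurable_funD.
      by apply: measurable_funeM; apply/measurable_EFinP; exact: measurable_indicT.
    exact: measurable_L1.
  - move=> u _; rewrite -EFinM -EFinD lee_fin big_cons.
    have -> : r * \1_(A r) u + \sum_(j <- rs) j * \1_(A j) u - (r * \1_G u + g u) =
      r * (\1_(A r) u - \1_G u) + (\sum_(j <- rs) j * \1_(A j) u - g u) by ring.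
    apply: (le_trans (ler_normD _ _)); rewrite lerD2r normrM ler_wpM2l//.
    rewrite !indicE /symdiff in_setU !in_setD.
    by case: (u \in A r); case: (u \in G);
      rewrite /= ?subrr ?normr0 ?subr0 ?sub0r ?normrN ?normr1.
rewrite ge0_integralD; [|exact: mE| | | |]; last 4 first.
- by move=> u _; rewrite -EFinM lee_fin mulr_ge0// indicE.
- apply: measurable_funTS; apply: measurable_funeM; apply/measurable_EFinP.
  exact: measurable_indicT.
- by move=> u _; rewrite lee_fin.
- by apply: measurable_funTS; exact: measurable_L1.
rewrite [e]splitr EFinD; apply: leeD => //.
rewrite ge0_integralZl; [|exact: mE| | |exact: normr_ge0]; last 2 first.
- by apply: measurable_funTS; apply/measurable_EFinP; exact: measurable_indicT.
- by move=> u _; rewrite lee_fin indicE.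
rewrite integral_indic// setIC.
apply: (@le_trans _ _ (`|r|%:E * e'%:E)%E).
  by apply: lee_wpmul2l => //; rewrite lee_fin.
rewrite -EFinM lee_fin /e' mulrCA; apply: ler_piMr; first exact: ltW.
by rewrite ler_pdivrMr// mul1r lerDl.
Qed.

(** Simple functions approximate [f] in L^1, and each of their finitely many level sets is replaced
    by a grid set. *)
Lemma integrable_grid_approx (E : set T) (f : T -> R) (e : R) :
  measurable E -> (mu E < +oo)%E -> mu.-integrable E (EFin \o f) -> 0 < e ->
  exists N g, gridfun N g /\
    (\int[mu]_(u in E) `|f u - g u|%:E <= e%:E)%E.
Proof.
move=> mE Efin intf e0; have e2 : 0 < e / 2 by rewrite divr_gt0.
have [s_ [_ _ cvgs]] := approximation_sfun_integrable mE intf.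
have e2E : (0 < (e / 2)%:E :> \bar R)%E by rewrite lte_fin.
have [k _ /(_ k (leqnn k)) /= /ltW hk] := cvgs _ (open_ereal_lt' e2E).
set s := s_ k in hk.
have msr r : measurable (s @^-1` [set r]).
  by rewrite -[X in measurable X]setTI; exact: measurable_funP.
pose rs := finmap.enum_fset (fset_set (range s)).
have [N [g [[mg gg] hg]]] := sum_indic_grid_approx rs mE Efin msr e2.
exists N, g; split=> //.
have mf : measurable_fun E f by apply/measurable_EFinP; case/integrableP: intf.
have ms : measurable_fun E s by exact: measurable_funTS.
have mg' : measurable_fun E g by exact: measurable_funTS.
apply: (@le_trans _ _ (\int[mu]_(u in E) (`|f u - s u|%:E + `|s u - g u|%:E))%E).
  apply: ge0_le_integral => //.
  - exact: measurable_L1.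
  - by apply: emeasurable_funD; exact: measurable_L1.
  - by move=> u _; rewrite -EFinD lee_fin ler_distD.
rewrite ge0_integralD//; [|exact: measurable_L1..].
rewrite [e]splitr EFinD; apply: leeD; first exact: hk.
move: hg; congr (_ <= _)%E; apply: eq_integral => u _.
by rewrite (fimfunE s u) fsbig_finite.
Qed.

End GridFunctions.

(** * Approximating a density by a positive one on a grid in a box *)

Section GridDensity.
Variables (R : realType) (n : nat).
Local Notation d := n.+1.
Local Notation mu := (leb R d).
Implicit Types rho : 'rV[R]_d -> R.

Lemma tuple_box_le (M K : nat) (u : d.-tuple R) : (M <= K)%N ->
  tuple_box M u -> tuple_box K u.
Proof.
move=> MK uM i; have /andP[l r] := uM i.
by rewrite (lt_le_trans r) ?ler_nat// (le_trans _ l)// lerN2 ler_nat.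
Qed.

Lemma density_integrable (E : set (d.-tuple R)) rho : measurable E -> density rho ->
  mu.-integrable E (EFin \o (rho \o @rV_of_tuple R d)).
Proof.
move=> mE [m p f]; apply: (@integrableS _ _ _ mu setT) => //.
apply/integrableP; split; first by apply/measurable_EFinP; exact: m.
under eq_integral do rewrite /= ger0_norm ?p//.
by move: f; rewrite lintegralE//; exact/borel_efunP.
Qed.

(** The successor in [M.+1] keeps the box nondegenerate, so that the number of cells along each axis
    is positive. *)
Lemma density_tail rho (e : R) : density rho -> 0 < e -> exists M,
  (\int[mu]_(u in ~` @tuple_box R d M.+1) (rho (rV_of_tuple u))%:E <= e%:E)%E.
Proof.
move=> dr e0; have [m p f] := dr.
pose B M (x : 'rV[R]_d) := ~~ `[< @tuple_box R d M.+1 (tuple_of_rV x) >].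
have mbox M := @measurable_tuple_box R d M.
have BE M (u : d.-tuple R) : (B M (rV_of_tuple u))%:R = \1_(~` tuple_box M.+1) u :> R.
  by rewrite /B rV_of_tupleK indicE in_setC -[u \in _]/(`[< _ >]).
have mB M : borel_fun (fun x => (B M x)%:R).
  rewrite /borel_fun (_ : _ \o _ = fun u => \1_(~` tuple_box M.+1) u).
    by apply: measurable_indicT; apply: measurableC.
  by apply/funext => u /=; rewrite BE.
have [|M hM] := lintegral_vanish dr mB _ e0.
  move=> x; have : (\bigcup_M @tuple_box R d M) (tuple_of_rV x).
    by rewrite bigcup_tuple_box.
  move=> [M0 _ xM]; exists M0 => // K /= MK; rewrite negbK; apply/asboolP.
  by apply: tuple_box_le xM; exact: leqW.
exists M; apply: le_trans hM.
rewrite lintegralE => [|| x]; last by rewrite lee_fin mulr_ge0.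
  rewrite integral_mkcond le_eqVlt; apply/orP; left; apply/eqP.
  apply: eq_integral => u _; rewrite BE patchE indicE.
  by case: ifP => _; rewrite ?mul1r ?mul0r.
by apply/borel_efunP; exact: borelM.
Qed.

Lemma density_grid rho (e : R) : density rho -> 0 < e ->
  exists p c m rho', [/\ forall i, 0 < c i, (forall i, 0 < m i)%N,
    @affine_gridpos R n p c m rho' & (L1dist rho rho' <= e%:E)%E].
Proof.
move=> dr e0; have [mr pr fr] := dr.
have e4 : 0 < e / 4 by rewrite divr_gt0.
have [M hM] := density_tail dr e4.
set K := M.+1 in hM; pose E : set (d.-tuple R) := tuple_box K.
have mE : measurable E by exact: measurable_tuple_box.
have Efin : (mu E < +oo)%E by exact: leb_box.
pose r := rho \o @rV_of_tuple R d.
have [N [g [[mg gg] hg]]] := integrable_grid_approx mE Efin (density_integrable mE dr) e4.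
have muE0 : 0 <= fine (mu E) by rewrite fine_ge0.
(* A floor of height [eta] costs at most [e / 4] over [E]; the added 1 keeps the quotient defined if
   [E] is null. *)
pose eta := e / 4 / (fine (mu E) + 1).
have eta0 : 0 < eta by rewrite divr_gt0// ltr_wpDl.
(* The maximum makes every cell positive and removes negative values of [g]. Since [rho] is
   nonnegative, it adds at most [eta] to the pointwise error. *)
pose h u := Num.max (g u) eta.
have h0 u : 0 < h u by rewrite /h lt_max eta0 orbT.
have mh : measurable_fun setT h by apply: measurable_maxr => //; exact: measurable_cst.
pose rho' (x : 'rV[R]_d) := \1_E (tuple_of_rV x) * h (tuple_of_rV x).
have mrho' : borel_fun rho'.
  rewrite /borel_fun (_ : _ \o _ = fun u => \1_E u * h u); last first.
    by apply/funext => u /=; rewrite /rho' rV_of_tupleK.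
  by apply: measurable_funM => //; exact: measurable_indicT.
have rho'0 x : 0 <= rho' x by rewrite mulr_ge0// ?indicE// ltW.
have L1 : (L1dist rho rho' <= e%:E)%E.
  rewrite /L1dist lintegralE; [|exact: borel_L1|by move=> x; rewrite lee_fin].
  under eq_integral do rewrite /rho' rV_of_tupleK.
  have mL (D : set (d.-tuple R)) : measurable_fun D (fun u => `|r u - \1_E u * h u|%:E).
    apply: measurable_funTS; apply: measurable_L1; first exact: mr.
    by apply: measurable_funM => //; exact: measurable_indicT.
  rewrite -(setvU E) ge0_integral_setU//; [|exact: measurableC|]; last first.
    by apply/disj_setPS => u [nEu Eu].
  (* One quarter pays for the tail outside [E], one for the grid approximation and one for the
     floor; one is slack. *)
  have -> : e = e / 4 + (e / 4 + e / 4 + e / 4) by field.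
  rewrite EFinD; apply: leeD.
    apply: le_trans hM; rewrite le_eqVlt; apply/orP; left; apply/eqP.
    apply: eq_integral => u; rewrite inE => nEu.
    by rewrite indicE memNset// mul0r subr0 ger0_norm.
  apply: (@le_trans _ _ (\int[mu]_(u in E) (`|r u - g u|%:E + eta%:E))%E).
    apply: ge0_le_integral => //.
    - apply: emeasurable_funD; last exact: measurable_cst.
      apply: measurable_funTS; apply: measurable_L1 => //; exact: mr.
    - move=> u Eu; rewrite indicE mem_set// mul1r -EFinD lee_fin /h /r /=.
      have r0 := pr (rV_of_tuple u).
      case: (leP (g u) eta) => geta; last by rewrite lerDl ltW.
      have := ler_norm (rho (rV_of_tuple u) - g u).
      have := ler_norm (- (rho (rV_of_tuple u) - g u)); rewrite normrN.
      by rewrite ler_norml => *; apply/andP; split; lra.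
  rewrite ge0_integralD//; last first.
  - by move=> u _; rewrite lee_fin ltW.
  - apply: measurable_funTS; apply: measurable_L1 => //; exact: mr.
  rewrite EFinD; apply: leeD.
    apply: (le_trans hg); rewrite lee_fin; lra.
  rewrite integral_cst//= -[mu E]fineK ?ge0_fin_numE// -EFinM lee_fin.
  by rewrite /eta mulrAC ler_pdivrMr ?ltr_wpDl// ler_pM2l// lerDl.
have dr' : density rho'.
  split=> //.
  apply: (@le_lt_trans _ _
    (lintegral (fun x => (rho x)%:E) + L1dist rho rho')%E).
    rewrite -lintegralD//; [|exact/borel_efunP|exact: borel_L1].
    apply: le_lintegral => [| |x|x]; rewrite ?lee_fin//; first exact/borel_efunP.
      by apply: emeasurable_funD; [exact/borel_efunP|exact: borel_L1].
    have := ler_norm (- (rho x - rho' x)); rewrite normrN => ?; lra.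
  by rewrite lte_add_pinfty//; apply: (le_lt_trans L1); rewrite ltry.
(* Shifting by [K] and scaling by [N.+1] takes the side from [- K] to [K] of the box to an interval
   from 0 of length [N.+1 * (K + K)], counted in cells. *)
exists (fun=> K%:R), (fun=> N.+1%:R), (fun=> (N.+1 * (K + K))%N), rho'; split=> //.
have boxE x : inbox (fun=> (N.+1 * (K + K))%N)
    (rescale (fun=> K%:R) (fun=> N.+1%:R) x) <-> E (tuple_of_rV x).
  split=> hx i; have := hx i; rewrite ?mxE ?tnth_mktuple natrM.
    rewrite pmulr_rge0// ltr_pM2l// natrD; lra.
  rewrite pmulr_rge0// ltr_pM2l// natrD; lra.
split=> //.
- move=> x y xy; have xE : E (tuple_of_rV x) <-> E (tuple_of_rV y).
    suff sub (a b : 'rV[R]_d) : (forall i,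
        Num.floor (rescale (fun=> K%:R) (fun=> N.+1%:R) a 0 i) =
        Num.floor (rescale (fun=> K%:R) (fun=> N.+1%:R) b 0 i)) ->
        E (tuple_of_rV a) -> E (tuple_of_rV b).
      by split; apply: sub => // i; rewrite xy.
    move=> ab /boxE aE; apply/boxE => i; have := aE i.
    set s := rescale _ _ a 0 i; set t := rescale _ _ b 0 i.
    have st : Num.floor s = Num.floor t by exact: ab.
    (* The faces of the box lie at integers of the rescaled coordinates, so membership depends only
       on integer parts. *)
    have cmp (k : int) : (k%:~R <= s) = (k%:~R <= t) by rewrite -!floor_ge_int st.
    have := cmp 0; have := cmp (Posz (N.+1 * (K + K))).
    by rewrite !ltNge => -> ->.
  have xy' : same_cell N (tuple_of_rV x) (tuple_of_rV y).
    move=> i; rewrite !tnth_mktuple; have := xy i; rewrite !mxE !mulrDr.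
    rewrite -natrM -[(N.+1 * K)%:R]/((Posz (N.+1 * K))%:~R).
    rewrite (floorDrz (N.+1%:R * x 0 i) (intr_int R _)).
    by rewrite (floorDrz (N.+1%:R * y 0 i) (intr_int R _)) => /addIr.
  rewrite /rho' /h (gg _ _ xy') !indicE; congr (_%:R * _).
  by congr nat_of_bool; apply/idP/idP; rewrite !inE => /xE.
- by move=> x /boxE xE; rewrite /rho' indicE mem_set// mul1r.
- by move=> x nx; rewrite /rho' indicE memNset ?mul0r// => /boxE.
Qed.

End GridDensity.

(** * Comparison of masses and conclusion *)

Section Steering.
Variables (R : realType) (n : nat).
Local Notation d := n.+1.
Implicit Types rho : 'rV[R]_d -> R.

Lemma reach_within_cube rho (e : R) : density rho -> 0 < e ->
  exists2 S : R, 0 < S & density (fun y => S * @unit_cube R n y) /\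
    reach_within e rho (fun y => S * @unit_cube R n y).
Proof.
move=> dr e0; have e2 : 0 < e / 2 by rewrite divr_gt0.
have [p [c [m [rho1 [c0 m0 g1 L1]]]]] := density_grid dr e2.
have [rho2 g2 r2] := affine_gridpos_reach c0 g1.
have [S S0 [d3 r3]] := gridpos_reach m0 g2.
exists S => //; split=> //.
case: dr g1 g2 d3 => [b0 _ _] [[b1 _ _] _ _ _] [[b2 _ _] _ _ _] [b3 _ _].
rewrite [e]splitr; apply: (reach_within_trans b0 b1 b3 (reach_within_L1 L1)).
exact: (reach_trans b1 b2 b3 r2 r3).
Qed.

Lemma lintegral_L1dist (f g : 'rV[R]_d -> R) : borel_fun f -> borel_fun g ->
  (forall x, 0 <= f x) -> (forall x, 0 <= g x) ->
  (lintegral (fun x => (f x)%:E) <= lintegral (fun x => (g x)%:E) + L1dist f g)%E.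
Proof.
move=> mf mg f0 g0; have mF := (borel_efunP f).2 mf; have mG := (borel_efunP g).2 mg.
rewrite -lintegralD//; last exact: borel_L1.
apply: le_lintegral => // [|x].
  by apply: emeasurable_funD => //; exact: borel_L1.
by rewrite -EFinD lee_fin -lerBlDl ler_norm.
Qed.

(** Transports preserve mass and an L^1 error bounds the change of mass. This controls the height of
    the cube reached, about which the construction itself says nothing. *)
Lemma reach_within_mass rho rho' (e : R) : prob_density rho -> density rho' ->
  reach_within e rho rho' ->
  `|fine (lintegral (fun x => (rho' x)%:E)) - 1| <= e.
Proof.
move=> [m [p i]] [m' p' i'] [Phi [Psi [J [tr h]]]].
have mE := (borel_efunP rho).2 m; have m'E := (borel_efunP rho').2 m'.
have mp := borel_push tr m.
have pp x : 0 <= push Psi J rho x by rewrite mulr_ge0// ltW// (transport_gt0 tr).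
have ip : lintegral (fun x => (push Psi J rho x)%:E) = 1%E.
  by rewrite -i -(lintegral_push tr mE)// => x; rewrite lee_fin.
have fin : lintegral (fun x => (rho' x)%:E) \is a fin_num.
  by rewrite ge0_fin_numE//; apply: lintegral_ge0 => // x; rewrite lee_fin.
have h1 := lintegral_L1dist mp m' pp p'; have h2 := lintegral_L1dist m' mp p' pp.
rewrite L1distC in h2; rewrite ip -(fineK fin) in h1 h2.
have {}h1 := le_trans h1 (leeD (lexx _) h); have {}h2 := le_trans h2 (leeD (lexx _) h).
rewrite -EFinD lee_fin in h1; rewrite -EFinD lee_fin in h2.
by rewrite ler_norml; apply/andP; split; lra.
Qed.

Lemma prob_density_density rho : prob_density rho -> density rho.
Proof. by move=> [m [p i]]; split=> //; rewrite i ltry. Qed.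

(** Each density reaches its own multiple of the cube within [e / 4]. Both multiples then have mass
    within [e / 4] of 1, and being proportional they are at L^1 distance equal to their mass
    difference, at most [e / 2]. *)
Lemma prob_density_reach rho0 rhoT (e : R) :
  prob_density rho0 -> prob_density rhoT -> 0 < e -> reach_within e rho0 rhoT.
Proof.
move=> p0 pT e0; have e4 : 0 < e / 4 by rewrite divr_gt0.
have d0 := prob_density_density p0; have dT := prob_density_density pT.
have [S S0 [dS rS]] := reach_within_cube d0 e4.
have [S' S'0 [dS' rS']] := reach_within_cube dT e4.
have mS := reach_within_mass p0 dS rS; have mS' := reach_within_mass pT dS' rS'.
have [bS pS iS] := dS; have [bS' pS' iS'] := dS'.
have [b0 _ _] := d0; have [bT _ _] := dT.
have bu : borel_fun (@unit_cube R n).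
  have := borelM (borel_cst S^-1) bS; congr borel_fun; apply/funext => x.
  by rewrite mulKf// gt_eqF.
have u0 x : 0 <= @unit_cube R n x by have := pS x; rewrite pmulr_rge0.
have uE := (borel_efunP _).2 bu.
have u0E x : (0 <= (@unit_cube R n x)%:E)%E by rewrite lee_fin.
pose k := lintegral (fun x => (@unit_cube R n x)%:E).
have k0 : (0 <= k)%E by exact: lintegral_ge0.
have massE (s : R) : 0 < s ->
    lintegral (fun x => (s * @unit_cube R n x)%:E) = (s%:E * k)%E.
  by move=> s0; rewrite -lintegralZl// ltW.
have kfin : k \is a fin_num.
  rewrite ge0_fin_numE//; move: iS; rewrite massE//.
  case: (k) k0 => [r _ _|_|//]; first exact: ltry.
  by rewrite gt0_muley ?lte_fin.
have mid : (L1dist (fun y => S * @unit_cube R n y)%R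
    (fun y => S' * @unit_cube R n y)%R <= (e / 4 + e / 4)%:E)%E.
  rewrite /L1dist (_ : (fun x => _) =
      fun x => (`|S - S'|%R%:E * (@unit_cube R n x)%:E)%E).
    rewrite lintegralZl// -/k -(fineK kfin) -EFinM lee_fin.
    move: mS mS'; rewrite !massE// -(fineK kfin) -!EFinM /=.
    have fk0 : 0 <= fine k by rewrite fine_ge0.
    have -> : `|S - S'| * fine k = `|S * fine k - S' * fine k|.
      by rewrite -mulrBl normrM (ger0_norm fk0).
    rewrite !ler_norml.
    by move=> /andP[? ?] /andP[? ?]; apply/andP; split; lra.
  by apply/funext => x; rewrite -mulrBl normrM (ger0_norm (u0 x)).
have -> : e = (e / 4 + (e / 4 + e / 4)) + e / 4 by field.
apply: (reach_within_trans b0 bS' bT _ (reach_within_sym bT bS' rS')).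
exact: (reach_within_trans b0 bS bS' rS (reach_within_L1 mid)).
Qed.

End Steering.

Theorem theorem1 (R : realType) (d : nat) (hd : (1 <= d)%N)
  (rho0 rhoT : 'rV[R]_d -> R) (T eps : R) :
  prob_density rho0 -> prob_density rhoT -> 0 < T -> 0 < eps ->
  exists (w a : R -> 'rV[R]_d) (b : R -> R),
    [/\ piecewise_constant T w, piecewise_constant T a,
        piecewise_constant T b &
    exists Phi : 'rV[R]_d -> R -> 'rV[R]_d,
      (forall x, characteristic T (relu_field w a b) (Phi x) x) /\
      exists rho_T' : 'rV[R]_d -> R,
        pushforward_density (fun x => Phi x T) rho0 rho_T' /\
        (L1dist rho_T' rhoT <= eps%:E)%E].
Proof.
(* Positive dimension supplies the coordinate 0 along which the cells are lined up. *)
case: d hd rho0 rhoT => // n _ rho0 rhoT p0 pT T0 eps0.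
have [Phi [Psi [J [tr h]]]] := prob_density_reach p0 pT eps0.
have [w [a [b [pw pa pb [X hX]]]]] := transport_steer tr T0.
exists w, a, b; split=> //; exists X; split.
  move=> x; have [X0 cX _ dX] := hX x; split=> //; split=> //.
  exact: continuous_subspaceT.
exists (push Psi J rho0); split=> //.
rewrite (_ : (fun x => X x T) = Phi); last by apply/funext => x; case: (hX x).
by case: p0 => m [p _]; exact: pushforward_density_push tr m p.
Qed.
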